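(* Let $n\ge 1$, let $E$ be a Polish space, let $X=(X_1,\dots,X_n)$ be a vector of independent $E$-valued random variables, and let $X'=(X_1',\dots,X_n')$ be an independent copy of $X$. Let $f:E^n\to\mathbb{R}$ be measurable and such that $W:=f(X)$ satisfies $\mathbf{E}W=0$ and $\mathbf{E}W^2=\sigma^2\in(0,\infty)$. Let $N\sim\mathcal{N}(0,1)$. Then, with $\kappa_{n,A}$, $T$, $T'$, $X^A$, $\Delta_j$ as defined in the context, $$ \begin{aligned} d_K(\sigma^{-1}W,N)\le{}& \frac{1}{\sigma^2}\sqrt{\mathbf{Var}(\mathbf{E}(T\mid X))}+\frac{1}{\sigma^2}\sqrt{\mathbf{Var}(\mathbf{E}(T'\mid X))}\\ &+\frac{1}{4\sigma^4}\,\mathbf{E}\sum_{A\subsetneq[n]}\sum_{j\notin A}\kappa_{n,A}\,|f(X)|\,\left|\Delta_jf(X,X')^2\,\Delta_jf(X^A,X')\right|+\frac{\sqrt{2\pi}}{16\sigma^3}\sum_{j=1}^n\mathbf{E}|\Delta_jf(X,X')|^3\\ \le{}& \frac{1}{\sigma^2}\sqrt{\mathbf{Var}(\mathbf{E}(T\mid X))}+\frac{1}{\sigma^2}\sqrt{\mathbf{Var}(\mathbf{E}(T'\mid X))}\\ &+\frac{1}{4\sigma^3}\sum_{j=1}^n\sqrt{\mathbf{E}|\Delta_jf(X,X')|^6}+\frac{\sqrt{2\pi}}{16\sigma^3}\sum_{j=1}^n\mathbf{E}|\Delta_jf(X,X')|^3 . \end{aligned} $$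
   Context: $[n]=\{1,\dots,n\}$. The Kolmogorov distance between real random variables $U,V$ is $d_K(U,V)=\sup_{t\in\mathbb{R}}|\mathbf{P}(U\le t)-\mathbf{P}(V\le t)|$. For $y,y'\in E^n$ and $j\in[n]$, $\Delta_jf(y,y')=f(y)-f(y_1,\dots,y_{j-1},y'_j,y_{j+1},\dots,y_n)$; the same notation is used with random vectors in place of $y,y'$. For $A\subseteq[n]$, $X^A=(X_1^A,\dots,X_n^A)$ is defined by $X_i^A=X_i$ if $i\notin A$ and $X_i^A=X_i'$ if $i\in A$. Thus, for $j\notin A$, $\Delta_jf(X^A,X')=f(X^A)-f(X^{A\cup\{j\}})$. For $A\subsetneq[n]$ (all proper subsets, including $\emptyset$), $\kappa_{n,A}=\dfrac{1}{\binom{n}{|A|}(n-|A|)}$, and $$T_A=\sum_{j\notin A}\Delta_jf(X,X')\,\Delta_jf(X^A,X'),\qquad T_A'=\sum_{j\notin A}\Delta_jf(X,X')\,|\Delta_jf(X^A,X')|,$$ $$T=\frac12\sum_{A\subsetneq[n]}\kappa_{n,A}T_A,\qquad T'=\frac12\sum_{A\subsetneq[n]}\kappa_{n,A}T_A'.$$ Quantities on the right-hand sides may be $+\infty$. *)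

(* Defs.v *)
From HB Require Import structures.
From mathcomp Require Import all_boot all_order all_algebra.
From mathcomp Require Import all_classical all_reals all_analysis.
Import Order.TTheory GRing.Theory Num.Theory.
Import numFieldNormedType.Exports.

Set Implicit Arguments.
Unset Strict Implicit.
Unset Printing Implicit Defensive.

Local Open Scope classical_set_scope.
Local Open Scope ring_scope.

Definition is_metric (R : realType) (E : Type) (dist : E -> E -> R) : Prop :=
  [/\ forall x y, 0 <= dist x y,
      forall x y, dist x y = 0 <-> x = y,
      forall x y, dist x y = dist y x &
      forall x y z, dist x z <= dist x y + dist y z].

Definition metric_induces_topology (R : realType) (E : topologicalType)
    (dist : E -> E -> R) : Prop :=
  forall (x : E) (A : set E),
    nbhs x A <-> exists2 e : R, 0 < e & [set y | dist x y < e] `<=` A.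

Definition metric_complete (R : realType) (E : topologicalType)
    (dist : E -> E -> R) : Prop :=
  forall u : nat -> E,
    (forall e : R, 0 < e -> exists N : nat, forall p q : nat,
       (N <= p)%N -> (N <= q)%N -> dist (u p) (u q) < e) ->
    exists l : E, u @ \oo --> l.

(* The metric is existentially quantified: a Polish space is a topological
   space, without a distinguished metric. *)
Definition polish_space (R : realType) (E : topologicalType) : Prop :=
  (exists dist : E -> E -> R,
     [/\ is_metric dist, metric_induces_topology dist & metric_complete dist])
  /\ (exists2 D : set E, countable D & dense D).

(* [E] with its Borel sigma-algebra.  The library then equips
   [n.-tuple (borel E)] with the product sigma-algebra, which is the Borel
   sigma-algebra of [E^n] when [E] is Polish. *)
Notation borel E := (g_sigma_algebraType (@open E)).

Section probability_notions.
Context {R : realType} {d} {Omega : measurableType d}.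
Variable P : probability Omega R.

Definition mutual_independence {d'} {S : measurableType d'} (n : nat)
    (Y : 'I_n -> Omega -> S) : Prop :=
  forall (J : {set 'I_n}) (B : 'I_n -> set S),
    (forall i, i \in J -> measurable (B i)) ->
    P (\bigcap_(i in [set` J]) (Y i @^-1` B i)) =
    (\prod_(i in J) P (Y i @^-1` B i))%E.

Definition independent_copy {d'} {S : measurableType d'}
    (X X' : Omega -> S) : Prop :=
  (forall B : set S, measurable B -> P (X' @^-1` B) = P (X @^-1` B)) /\
  (forall A B : set S, measurable A -> measurable B ->
     P (X @^-1` A `&` X' @^-1` B) = (P (X @^-1` A) * P (X' @^-1` B))%E).

(* [Y] is a version of the conditional expectation of [Z] given the
   sigma-algebra generated by [X]. *)
Definition is_cond_expectation {d'} {S : measurableType d'}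
    (X : Omega -> S) (Z Y : Omega -> R) : Prop :=
  [/\ measurable_fun [set: g_sigma_algebra_preimageType X] Y,
      P.-integrable [set: Omega] (EFin \o Y) &
      forall B : set Omega, g_sigma_algebra_preimage X B ->
        (\int[P]_(w in B) (Y w)%:E = \int[P]_(w in B) (Z w)%:E)%E].

End probability_notions.

(* [U] and [V] need not be defined on the same probability space. *)
Definition kolmogorov_distance {R : realType} {d1 d2}
    {O1 : measurableType d1} {O2 : measurableType d2}
    (P1 : probability O1 R) (P2 : probability O2 R)
    (U : O1 -> R) (V : O2 -> R) : \bar R :=
  ereal_sup (range (fun t : R =>
    (`|P1 [set w | (U w <= t)%R] - P2 [set w | (V w <= t)%R]|)%E)).

Definition standard_normal {R : realType} {d} {Omega : measurableType d}
    (P : probability Omega R) (N : Omega -> R) : Prop :=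
  forall B : set R, measurable B -> P (N @^-1` B) = normal_prob 0 1 B.

Section stein_quantities.
Context {R : realType} {E : Type} {n : nat}.
Implicit Types (x y : n.-tuple E) (A : {set 'I_n}).

(* x^A: the coordinates of x indexed by A are replaced by those of x'. *)
Definition resample A x x' : n.-tuple E :=
  [tuple (if i \in A then tnth x' i else tnth x i) | i < n].

Definition Delta (f : n.-tuple E -> R) (j : 'I_n) y y' : R :=
  f y - f (resample [set j]%SET y y').

Definition kappa A : R := (('C(n, #|A|) * (n - #|A|))%N%:R)^-1.

Definition Tsub (f : n.-tuple E -> R) A x x' : R :=
  \sum_(j | j \notin A) Delta f j x x' * Delta f j (resample A x x') x'.

Definition Tsub' (f : n.-tuple E -> R) A x x' : R :=
  \sum_(j | j \notin A) Delta f j x x' * `|Delta f j (resample A x x') x'|.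

Definition Tsum (f : n.-tuple E -> R) x x' : R :=
  2^-1 * \sum_(A : {set 'I_n} | A \proper [set: 'I_n]%SET)
    kappa A * Tsub f A x x'.

Definition Tsum' (f : n.-tuple E -> R) x x' : R :=
  2^-1 * \sum_(A : {set 'I_n} | A \proper [set: 'I_n]%SET)
    kappa A * Tsub' f A x x'.

End stein_quantities.

(* Main.v *)
(* Stein's method with the exchangeable resampling of Chatterjee. For the
   solution g of g'(w) - w g(w) = 1{w <= t} - Phi(t), the covariance formula
   E[f(X) g(W)] = E[(1/2) sum_A kappa_A sum_(j notin A)
   Delta_j(g o f)(X, X') Delta_j f(X^A, X')] follows from swapping X_j with X'_j
   and from the fact that sum_A kappa_A sum_(j notin A) (f(X^A) - f(X^(A+j)))
   telescopes to f(X) - f(X'). Expand Delta_j(g o f) to first order: the linear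
   term produces T, and in the remainder the part of g' that is Lipschitz gives
   the two moment terms. The indicator part of g' contributes at most
   Delta_j f (1{f(X^j) <= t} - 1{f(X) <= t}), which is nonnegative because the
   indicator is monotone; by antisymmetry under the swap its total is
   E[T' (1 - 2 1{W <= t})] up to a constant, and E T' = 0, so that it is bounded
   by the standard deviation of E(T' | X). *)
Require Import Defs.
From HB Require Import structures.
From mathcomp Require Import all_boot all_order all_algebra.
From mathcomp Require Import all_classical all_reals all_analysis.
From mathcomp Require Import measurable_realfun ring lra.
Import Order.TTheory GRing.Theory Num.Theory.
Import numFieldNormedType.Exports.

Set Implicit Arguments.
Unset Strict Implicit.
Unset Printing Implicit Defensive.

Local Open Scope classical_set_scope.
Local Open Scope ring_scope.

(** * The normal distribution function *)

Section monotonicity.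
Context {R : realType}.

(** Two obstacles shape the proof. The derivative g' jumps at [t], so g has no global second-order
    Taylor bound. After removal of the piecewise linear part that carries the jump, the derivative
    is w g(w), whose increments from w are at most (|w| + sqrt(2 pi)/4) |x - w|: g is 1-Lipschitz,
    and its largest value, taken at [t], is Phi(t)(1 - Phi(t)) over the density at [t]. The factor
    |w| is the origin of |f(X)| in the third term of the bound, the constant is the origin of sqrt(2
    pi)/16 in the last one. Calculus is therefore done with monotonicity statements that tolerate
    one exceptional point instead of second derivatives.

    The other obstacle is integrability: only f(X) is square integrable. T and T' are then merely
    integrable, so conditional expectations are tested against bounded functions of f(X) only, and
    every upper bound is computed in the extended reals, where nonnegativity replaces finiteness. *)

Lemma derive_le0_nincr_except (F dF : R -> R) (t a b : R) :
  a <= b -> continuous F ->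
  (forall x, a < x < b -> x != t -> is_derive x 1 F (dF x)) ->
  (forall x, a < x < b -> x != t -> dF x <= 0) ->
  F b <= F a.
Proof.
move=> ab cF dFP dF0.
(* An interval with [t] outside its interior has no exceptional point; an interval straddling [t] is
   split there, and continuity at [t] joins the two halves. *)
have cut u v : a <= u -> u <= v -> v <= b -> (v <= t \/ t <= u) -> F v <= F u.
  move=> au uv vb tuv.
  have inuv x : x \in `]u, v[ -> (a < x < b) /\ x != t.
    rewrite in_itv/= => /andP[ux xv]; split.
      by rewrite (le_lt_trans au ux) (lt_le_trans xv vb).
    case: tuv => [vt|tu]; first by rewrite lt_eqF// (lt_le_trans xv vt).
    by rewrite gt_eqF// (le_lt_trans tu ux).
  apply: (@ler0_derive1_le_cc _ F u v) => //.
  - by move=> x /inuv[xab xt]; have H := dFP _ xab xt; exact: ex_derive.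
  - move=> x /inuv[xab xt]; rewrite derive1E; have H := dFP _ xab xt.
    by rewrite derive_val dF0.
  - exact: continuous_subspaceT.
  - by rewrite in_itv/= lexx uv.
  - by rewrite in_itv/= lexx uv.
have [bt|tb] := leP b t; first by apply: cut => //; left.
case: (leP t a) => [t_le_a|a_lt_t]; first by apply: cut => //; right.
apply: (@le_trans _ _ (F t)).
  by apply: cut; rewrite ?(ltW a_lt_t) ?(ltW tb)//; right.
by apply: cut; rewrite ?(ltW a_lt_t) ?(ltW tb)//; left.
Qed.

End monotonicity.

Section gaussian.
Context {R : realType}.
Implicit Types x y : R.

Definition gdens x : R := (Num.sqrt (2 * pi))^-1 * expR (- (x ^+ 2 / 2)).

Definition gcdf x : R := fine (normal_prob 0 1 `]-oo, x]).

Lemma sqrt2pi_gt0 : 0 < Num.sqrt (2 * pi) :> R.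
Proof. by rewrite sqrtr_gt0 mulr_gt0// pi_gt0. Qed.

Lemma gdensE : gdens = normal_pdf 0 1.
Proof.
apply/funext => x; rewrite normal_pdfE ?oner_neq0// /normal_peak /normal_fun.
rewrite /gdens subr0 expr1n mul1r (mulr_natl pi) mulNr.
by [].
Qed.

Lemma gdens_gt0 x : 0 < gdens x.
Proof. by rewrite mulr_gt0 ?expR_gt0// invr_gt0 sqrt2pi_gt0. Qed.

Lemma gdensN x : gdens (- x) = gdens x.
Proof. by rewrite /gdens sqrrN. Qed.

Lemma is_derive_gdens x : is_derive x 1 gdens (- x * gdens x).
Proof.
have H : is_derive x 1 (fun x : R => - (x ^+ 2 / 2)) (- x).
  have -> : (fun x : R => - (x ^+ 2 / 2)) = (- 2^-1) *: (@id R ^+ 2).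
    by apply/funext => y; rewrite -[RHS]/(- 2^-1 * y ^+ 2); field.
  apply: is_derive_eq.
  by rewrite /GRing.scale/=; field.
rewrite /gdens; set c := (Num.sqrt _)^-1.
have -> : (fun x => c * expR (- (x ^+ 2 / 2))) =
    c *: (expR \o (fun x : R => - (x ^+ 2 / 2))) by [].
apply: is_derive_eq.
by rewrite /GRing.scale/=; ring.
Qed.

Lemma gcdf_fin x : (gcdf x)%:E = normal_prob 0 1 `]-oo, x].
Proof. by rewrite fineK// fin_num_measure. Qed.

Lemma is_derive_gcdf x : is_derive x 1 gcdf (gdens x).
Proof.
have [||||] := @continuous_FTC1 R gdens -oo%O x (x + 1).
- by rewrite ltrDl.
- apply: (@integrableS _ _ _ lebesgue_measure setT) => //.
  rewrite gdensE; exact: integrable_normal_pdf.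
- by rewrite ltNyr.
- by rewrite gdensE => ?; apply: continuous_normal_pdf; rewrite oner_neq0.
rewrite gdensE => d <-; rewrite derive1E.
exact/derivableP.
Qed.

Lemma gcdf_ge0 x : 0 <= gcdf x.
Proof. by rewrite -lee_fin gcdf_fin. Qed.

Lemma gcdf_le1 x : gcdf x <= 1.
Proof. by rewrite -lee_fin gcdf_fin probability_le1. Qed.

Lemma continuous_gcdf : continuous gcdf.
Proof.
move=> x; apply/differentiable_continuous/derivable1_diffP.
by have := is_derive_gcdf x => ?; exact: ex_derive.
Qed.

(** Under the normal law the identity is a random variable with distribution function [gcdf], so the
    general limits of distribution functions apply. *)
Let idR : measurableTypeR R -> R := idfun.

#[local] HB.instance Definition _ :=
  @isMeasurableFun.Build _ _ _ _ idR (@measurable_id _ _ setT).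

Lemma cvg_gcdfy : gcdf x @[x --> +oo] --> (1 : R).
Proof. by have /fine_cvg := cvg_cdfy1 (idR : {RV (@normal_prob R 0 1) >-> R}). Qed.

Lemma cvg_gcdfNy : gcdf x @[x --> -oo] --> (0 : R).
Proof. by have /fine_cvg := cvg_cdfNy0 (idR : {RV (@normal_prob R 0 1) >-> R}). Qed.

Lemma gcdf_le x y : x <= y -> gcdf x <= gcdf y.
Proof.
move=> xy; rewrite -lee_fin !gcdf_fin le_measure ?inE//.
exact: subset_itvl.
Qed.

(** The density is even, so [gcdf y + gcdf (- y)] has zero derivative; the constant is its limit 1
    at infinity. *)
Lemma gcdfN x : gcdf (- x) = 1 - gcdf x.
Proof.
pose s y := gcdf y + gcdf (- y).
have ds y : is_derive y 1 s 0.
  have H1 := is_derive_gcdf y; have H2 := is_derive_gcdf (- y).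
  have -> : s = gcdf + (gcdf \o -%R) by [].
  apply: is_derive_eq.
  by rewrite gdensN; ring.
have sx y : s y = s x by exact: is_derive_0_is_cst.
suff : s x = 1 by rewrite /s => <-; ring.
have s1 : s y @[y --> +oo] --> (1 + 0 : R).
  apply: cvgD; first exact: cvg_gcdfy.
  by move/cvgNy_compNP : cvg_gcdfNy.
rewrite addr0 in s1.
have s2 : s y @[y --> +oo] --> s x.
  by under eq_fun do rewrite sx; exact: cvg_cst.
exact: (cvg_unique _ s2 s1).
Qed.

(* The difference [gdens x / x - (1 - gcdf x)] decreases to 0. *)
Lemma mills_ratio x : 0 <= x -> x * (1 - gcdf x) <= gdens x.
Proof.
rewrite le_eqVlt => /predU1P[<-|x0]; first by rewrite mul0r ltW// gdens_gt0.
pose k y := gdens y * y^-1 + gcdf y.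
have dk y : 0 < y -> is_derive y 1 k (- gdens y / y ^+ 2).
  move=> y0; have y0' : y != 0 by rewrite gt_eqF.
  have H1 := is_derive_gcdf y; have H2 := is_derive_gdens y.
  have H3 := is_deriveV y0' (is_derive_id y 1).
  have -> : k = gdens * (fun y => y^-1) + gcdf by [].
  apply: is_derive_eq.
  rewrite /GRing.scale/=; field.
  exact: y0'.
have kx y : x <= y -> k y <= k x.
  move=> xy.
  apply: (@ler0_derive1_le_cc _ k x y) => //.
  - move=> z; rewrite in_itv/= => /andP[xz _].
    by have H := dk z (lt_trans x0 xz); exact: ex_derive.
  - move=> z; rewrite in_itv/= => /andP[xz _]; rewrite derive1E.
    have z0 := lt_trans x0 xz; have H := dk z z0.
    by rewrite derive_val mulNr oppr_le0 divr_ge0 ?sqr_ge0// ltW// gdens_gt0.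
  - apply: (@derivable_within_continuous R R^o k `[x, y]) => z.
    rewrite in_itv/= => /andP[xz _].
    by have H := dk z (lt_le_trans x0 xz); exact: ex_derive.
  - by rewrite in_itv/= lexx xy.
  - by rewrite in_itv/= lexx xy.
have : 1 <= k x.
  apply: (@cvgr_to_le _ _ _ _ _ _ _ cvg_gcdfy).
  near=> y; apply: le_trans (kx y _) => //.
  by rewrite /k lerDr divr_ge0 ?(ltW (gdens_gt0 _))// (le_trans (ltW x0)).
by rewrite /k -lerBlDr ler_pdivlMr// mulrC.
Unshelve. all: by end_near. Qed.

Lemma gdens_nincr x y : 0 <= x -> x <= y -> gdens y <= gdens x.
Proof.
move=> x0 xy; rewrite ler_pM2l ?invr_gt0 ?sqrt2pi_gt0// ler_expR lerN2.
by rewrite ler_pM2r// ler_sqr// nnegrE (le_trans x0).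
Qed.

Lemma gcdf0 : gcdf 0 = 2^-1.
Proof. by have := gcdfN 0; rewrite oppr0; lra. Qed.

(** This fixes the constant [sqrt (2 pi) / 4]: with it, [gcdf_variance_le] is an equality at 0,
    hence it cannot be lowered there. *)
Lemma gdens0 : Num.sqrt (2 * pi) / 4 * gdens 0 = 4^-1 :> R.
Proof.
rewrite /gdens expr0n mul0r oppr0 expR0 mulr1 mulrAC mulfV ?mul1r//.
by rewrite gt_eqF ?sqrt2pi_gt0.
Qed.

(* The difference of the two sides has derivative [gdens * r], where [r] is
   convex on the half-line with [r 0 = 0]: it first decreases from 0, then
   increases to 0. *)
Lemma gcdf_variance_le x :
  gcdf x * (1 - gcdf x) <= Num.sqrt (2 * pi) / 4 * gdens x.
Proof.
(* Both sides are even in [x]. *)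
wlog x0 : x / 0 <= x => [H|].
  have [|x0] := leP 0 x; first exact: H.
  by have := H (- x); rewrite gdensN gcdfN subKr mulrC; apply; lra.
set c : R := Num.sqrt (2 * pi) / 4.
have c0 : 0 < c by rewrite divr_gt0 ?sqrt2pi_gt0.
move: x0; rewrite le_eqVlt => /predU1P[<-|x0].
  by rewrite gdens0 gcdf0; lra.
pose r (y : R) : R := 1 - 2 * gcdf y + c * y.
have dr y : is_derive y 1 r (c - 2 * gdens y).
  have H1 := is_derive_gcdf y.
  have -> : r = cst 1 - 2 *: gcdf + c *: id by [].
  by apply: is_derive_eq; rewrite /GRing.scale/=; ring.
have cr : continuous r.
  move=> y; apply/differentiable_continuous/derivable1_diffP.
  by have H := dr y; exact: ex_derive.
pose q y := gcdf y * (1 - gcdf y) - c * gdens y.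
have dq y : is_derive y 1 q (gdens y * r y).
  have H1 := is_derive_gcdf y; have H2 := is_derive_gdens y.
  have -> : q = gcdf * (cst 1 - gcdf) - c *: gdens by [].
  by apply: is_derive_eq; rewrite /GRing.scale/= /r !fctE; ring.
have cq : continuous q.
  move=> y; apply/differentiable_continuous/derivable1_diffP.
  by have H := dq y; exact: ex_derive.
have r0 : r 0 = 0 by rewrite /r gcdf0; lra.
have r_ge0 y z : 0 < y -> 0 <= r y -> y <= z -> 0 <= r z.
  move=> y0 ry yz; apply: (le_trans ry).
  (* Since [r 0 = 0], a nonnegative [r y] forces a nonnegative derivative at some [u < y]; the
     density decreases, so the derivative stays nonnegative beyond [u]. *)
  have [u] := @MVT _ r (fun y => c - 2 * gdens y) 0 y y0
    (fun t _ => dr t) (continuous_subspaceT cr).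
  rewrite in_itv/= => /andP[u0 uy]; rewrite r0 !subr0 => ruy.
  have du : 0 <= c - 2 * gdens u by move: ry; rewrite ruy pmulr_lge0.
  rewrite -lerN2.
  apply: (@derive_le0_nincr_except R (- r) (fun y => - (c - 2 * gdens y)) 0 y z)
    => // [t|t /andP[yt _] _].
  - by apply: continuousN; exact: cr.
  - rewrite oppr_le0 (le_trans du)// lerB// ler_pM2l//.
    by apply: gdens_nincr; rewrite ltW// (lt_trans uy).
suff : q x <= 0 by rewrite /q subr_le0.
have [rx|rx] := leP 0 (r x).
  have qx y : x <= y -> q x <= q y.
    move=> xy; rewrite -lerN2.
    apply: (@derive_le0_nincr_except R (- q) (fun y => - (gdens y * r y)) 0 x y)
      => // [t|t /andP[xt _] _].
    - by apply: continuousN; exact: cq.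
    - by rewrite oppr_le0 mulr_ge0 ?(ltW (gdens_gt0 _))// (r_ge0 x)// ltW.
  (* For large [y], [q x <= q y <= 1 - gcdf y]; passing to the limit in [gcdf y <= 1 - q x] uses
     only the limit of [gcdf], not that of the density. *)
  suff : 1 <= 1 - q x by lra.
  apply: (@cvgr_to_le _ _ _ _ _ _ _ cvg_gcdfy).
  near=> y; have xy : x <= y by [].
  have := qx y xy; rewrite /q => H.
  have H1 : 0 <= c * gdens y by rewrite mulr_ge0 ?(ltW (gdens_gt0 _))// ltW.
  have H2 := gcdf_ge0 y; have H3 := gcdf_le1 y.
  by nra.
have q0 : q 0 = 0 by rewrite /q gcdf0 gdens0; lra.
rewrite -q0.
apply: (@derive_le0_nincr_except R q (fun y => gdens y * r y) 0 0 x)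
  => // [|t /andP[t0 tx] _]; first exact: ltW.
(* A nonnegative value of [r] before [x] would persist up to [x], so [q] decreases from
   [q 0 = 0]. *)
rewrite pmulr_rle0 ?gdens_gt0// leNgt; apply/negP => /ltW rt.
by have := r_ge0 t x t0 rt (ltW tx); rewrite leNgt rx.
Unshelve. all: by end_near. Qed.

End gaussian.

(** * The Stein equation *)

Section stein_solution.
Context {R : realType}.
Implicit Types t w v x y : R.

(** The function [m x - x * k], taken with either sign, grows no faster than [b * (x - w) ^+ 2 / 2]
    when moving away from [w]. In the proof, [e] is the sign coming from the absolute value and [d]
    the side of [w] on which [v] lies. *)
Lemma first_order_remainder_le (m dm : R -> R) (t k b w v : R) :
  continuous m ->
  (forall x, x != t -> is_derive x 1 m (dm x)) ->
  (forall x, `|dm x - k| <= b * `|x - w|) ->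
  `|m v - m w - (v - w) * k| <= b * (v - w) ^+ 2 / 2.
Proof.
move=> cm dmP dmk.
pose F (e d x : R) : R := e * (m x - x * k) - d * (b * (x - w) ^+ 2 / 2).
pose dF (e d x : R) : R := e * (dm x - k) - d * (b * (x - w)).
have F_derive e d x : x != t -> is_derive x 1 (F e d) (dF e d x).
  move=> /dmP H.
  have -> : F e d = e *: (m - k *: id) - (d * b / 2) *: ((id - cst w) ^+ 2).
    apply/funext => y.
    rewrite -[RHS]/(e * (m y - k * y) - (d * b / 2) * (y - w) ^+ 2) /F; ring.
  apply: is_derive_eq.
  by rewrite /GRing.scale/= /dF !fctE; field.
have F_cont e d : continuous (F e d).
  move=> x; apply: cvgB; apply: cvgM; try exact: cvg_cst.
    by apply: cvgB; [exact: cm|apply: cvgM; [exact: cvg_id|exact: cvg_cst]].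
  apply: cvgM; last exact: cvg_cst.
  apply: cvgM; first exact: cvg_cst.
  rewrite expr2; under eq_fun do rewrite expr2.
  by apply: cvgM; apply: cvgB; try exact: cvg_id; exact: cvg_cst.
have nincr e d p q : `|e| = 1 -> p <= q ->
    (forall x, p < x < q -> d * (x - w) = `|x - w|) -> F e d q <= F e d p.
  move=> e1 pq dxw.
  apply: (@derive_le0_nincr_except R (F e d) (dF e d) t p q) => // x /dxw xpq xt.
  rewrite /dF subr_le0 mulrCA xpq; apply: le_trans (dmk x).
  by rewrite (le_trans (ler_norm _))// normrM e1 mul1r.
have F0 e d : F e d w = e * (m w - w * k) by rewrite /F subrr expr0n/=; ring.
rewrite ler_norml; have [wv|/ltW vw] := leP w v.
  have H e : `|e| = 1 -> F e 1 v <= F e 1 w.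
    move=> e1; apply: nincr => // x /andP[wx _].
    by rewrite mul1r ger0_norm// subr_ge0 ltW.
  have := H 1 (normr1 _); have := H (-1) _.
  rewrite normrN normr1 !F0 /F => /(_ erefl); lra.
have H e : `|e| = 1 -> F e (-1) w <= F e (-1) v.
  move=> e1; apply: nincr => // x /andP[_ xw].
  by rewrite mulN1r ler0_norm// subr_le0 ltW.
have := H 1 (normr1 _); have := H (-1) _.
by rewrite normrN normr1 !F0 /F => /(_ erefl); lra.
Qed.

(** Off [t], the derivative of [min y t] is exactly the indicator of [y <= t], so subtracting it
    removes the jump of [dstein t]. *)
Lemma is_derive_subminD (s : R -> R) (c ds t x : R) :
  is_derive x 1 s ds -> x != t ->
  is_derive x 1 (fun y => s y - Num.min y t + c * y) (ds - (x <= t)%R%:R + c).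
Proof.
move=> Hs xt; have : (x < t) || (t < x) by rewrite -neq_lt.
move=> /orP[{}xt|tx].
  have H := is_deriveD (is_deriveB Hs (is_derive_id x 1))
    (is_deriveZ c (is_derive_id x 1)).
  have {}H := near_eq_is_derive _ H.
  rewrite (ltW xt) mulr1n -[X in _ + X]mulr1; apply: H.
  near=> y; rewrite min_l//; apply: ltW.
  by near: y; exact: lt_nbhsl.
have H := is_deriveD (is_deriveB Hs (is_derive_cst t x 1))
  (is_deriveZ c (is_derive_id x 1)).
have {}H := near_eq_is_derive _ H.
rewrite leNgt tx mulr0n -[X in _ + X]mulr1; apply: H.
near=> y; rewrite min_r//; apply: ltW.
by near: y; exact: lt_nbhsr.
Unshelve. all: by end_near. Qed.

(** The bounded solution of the Stein equation; the minimum merges its two branches, separated in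
    [stein_le] and [stein_ge]. *)
Definition stein t w : R := (gcdf (Num.min w t) - gcdf w * gcdf t) / gdens w.

(** Defined by the Stein equation, which therefore holds at every [w]. At the kink [w = t] the
    indicator selects the left derivative. *)
Definition dstein t w : R := w * stein t w + (w <= t)%R%:R - gcdf t.

Lemma stein_le t w : w <= t -> stein t w = (1 - gcdf t) * (gcdf w / gdens w).
Proof. by move=> wt; rewrite /stein (min_idPl wt); ring. Qed.

Lemma stein_ge t w : t <= w -> stein t w = gcdf t * ((1 - gcdf w) / gdens w).
Proof. by move=> tw; rewrite /stein (min_idPr tw); ring. Qed.

(** Reflection exchanges the two branches, so estimates proved for [w <= t] transfer to the other
    side. *)
Lemma steinN t w : stein (- t) (- w) = stein t w.
Proof.
have [wt|/ltW tw] := leP w t.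
  by rewrite stein_ge ?lerN2// stein_le// !gcdfN subKr gdensN.
by rewrite stein_le ?lerN2// stein_ge// !gcdfN subKr gdensN.
Qed.

Lemma stein_ge0 t w : 0 <= stein t w.
Proof.
have := gcdf_ge0 w; have := gcdf_le1 w; have := gcdf_ge0 t; have := gcdf_le1 t.
move=> t1 t0 w1 w0; have p0 := gdens_gt0 w.
by have [wt|/ltW tw] := leP w t; [rewrite stein_le|rewrite stein_ge] => //;
  rewrite mulr_ge0 ?divr_ge0 ?subr_ge0// ltW.
Qed.

(** Here [dstein t w = (1 - gcdf t) * (1 + w * L)]. The Mills inequality at [w] gives the upper
    bound when [w] is nonnegative; at [- w] it gives the positivity of the second factor when [w] is
    negative. The remaining bounds are read off the signs. *)
Lemma dstein_le t w : w <= t -> 0 <= dstein t w <= 1.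
Proof.
move=> wt; rewrite /dstein wt stein_le//.
set L := gcdf w / gdens w.
have -> : w * ((1 - gcdf t) * L) + 1%:R - gcdf t = (1 - gcdf t) * (1 + w * L).
  by rewrite mulr1n; ring.
have t1 := gcdf_le1 t; have t0 := gcdf_ge0 t.
have w1 := gcdf_le1 w; have w0 := gcdf_ge0 w.
have p0 := gdens_gt0 w.
have wLp : w * L * gdens w = w * gcdf w by rewrite /L mulrA divfK// gt_eqF.
have L0 : 0 <= L by rewrite divr_ge0// ltW.
have [w_ge0|w_lt0] := leP 0 w.
  have wL0 : 0 <= w * L by rewrite mulr_ge0.
  rewrite mulr_ge0 ?subr_ge0//=; last by lra.
  have M := mills_ratio w_ge0.
  apply: (@le_trans _ _ ((1 - gcdf w) * (1 + w * L))).
    by rewrite ler_wpM2r ?addr_ge0// lerB// gcdf_le.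
  have -> : (1 - gcdf w) * (1 + w * L) =
      1 - gcdf w * (gdens w - w * (1 - gcdf w)) / gdens w.
    by rewrite /L; field; rewrite gt_eqF.
  by rewrite lerBlDr lerDl divr_ge0 ?mulr_ge0 ?subr_ge0// ltW.
have nw : 0 <= - w by rewrite oppr_ge0 ltW.
have := mills_ratio nw; rewrite gcdfN subKr gdensN => M.
have wL : 0 <= 1 + w * L.
  rewrite -(pmulr_lge0 _ p0) mulrDl wLp mul1r; lra.
have wL1 : w * L <= 0 by rewrite nmulr_rle0.
rewrite mulr_ge0 ?subr_ge0//=.
by rewrite mulr_ile1 ?subr_ge0//; lra.
Qed.

(** At [w = t] the two sides differ by 1, because both indicators are then equal to 1. *)
Lemma dsteinN t w : w != t -> dstein (- t) (- w) = - dstein t w.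
Proof.
move=> wt; rewrite /dstein steinN gcdfN lerN2.
by have [tw|wt'|] := ltgtP w t; [| |move/eqP: wt => //]; rewrite ?mulr1n ?mulr0n; ring.
Qed.

Lemma dstein_gt t w : t < w -> -1 <= dstein t w <= 0.
Proof.
move=> tw; have := @dstein_le (- t) (- w).
by rewrite dsteinN ?gt_eqF// lerN2 => /(_ (ltW tw)); lra.
Qed.

Lemma normr_dstein_le1 t w : `|dstein t w| <= 1.
Proof.
by rewrite ler_norml; have [/dstein_le|/dstein_gt] := leP w t; lra.
Qed.

Lemma continuous_stein t : continuous (stein t).
Proof.
move=> w.
have cp : {for w, continuous (@gdens R)}.
  apply/differentiable_continuous/derivable1_diffP.
  by have := is_derive_gdens w => ?; exact: ex_derive.
apply: cvgM.
  apply: cvgB; last by apply: cvgM; [exact: continuous_gcdf|exact: cvg_cst].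
  apply: (@continuous_comp _ _ _ (fun y => Num.min y t) gcdf).
    by apply: continuous_min; [exact: cvg_id|exact: cvg_cst].
  exact: continuous_gcdf.
by apply: cvgV; [rewrite gt_eqF ?gdens_gt0|exact: cp].
Qed.

Lemma is_derive_stein t w : w != t -> is_derive w 1 (stein t) (dstein t w).
Proof.
move=> wt; have p0 := gdens_gt0 w.
have pn0 : gdens w != 0 by rewrite gt_eqF.
have Hp := is_derive_gdens w; have HP := is_derive_gcdf w.
have HV := is_deriveV pn0 Hp.
have : (w < t) || (t < w) by rewrite -neq_lt.
move=> /orP[{}wt|tw].
  apply: (@near_eq_is_derive _ _ _ ((1 - gcdf t) *: (gcdf * (fun y => (gdens y)^-1)))).
    near=> y; rewrite stein_le//; apply: ltW.
    by near: y; exact: lt_nbhsl.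
  apply: is_derive_eq.
  by rewrite /dstein stein_le ?(ltW wt)// /GRing.scale/= mulr1n; field.
apply: (@near_eq_is_derive _ _ _
    (gcdf t *: ((cst 1 - gcdf) * (fun y => (gdens y)^-1)))).
  near=> y; rewrite stein_ge//; apply: ltW.
  by near: y; exact: lt_nbhsr.
apply: is_derive_eq.
rewrite /dstein stein_ge ?(ltW tw)// leNgt tw /GRing.scale/= mulr0n !fctE.
by field.
Unshelve. all: by end_near. Qed.

Lemma stein_lipschitz t x y : `|stein t y - stein t x| <= `|y - x|.
Proof.
wlog xy : x y / x <= y => [H|].
  have [|/ltW] := leP x y; first exact: H.
  by move=> /H; rewrite distrC [leRHS]distrC.
rewrite [leRHS]ger0_norm ?subr_ge0// ler_norml.
have c1 e : continuous (e *: stein t - id).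
  move=> z; apply: cvgB; last exact: cvg_id.
  by apply: cvgM; [exact: cvg_cst|exact: continuous_stein].
have H e : `|e| = 1 -> e * stein t y - y <= e * stein t x - x.
  move=> e1.
  apply: (@derive_le0_nincr_except R (e *: stein t - id)
    (fun z => e * dstein t z - 1) t x y) => // z _ zt.
    by have := is_derive_stein zt => ?; exact: is_deriveB.
  rewrite subr_le0 (le_trans (ler_norm _))// normrM e1 mul1r.
  exact: normr_dstein_le1.
have := H 1 (normr1 _); have := H (-1) _.
by rewrite normrN normr1 => /(_ erefl); lra.
Qed.

(** By the signs of [dstein], the solution increases up to [t] and decreases after it; the value at
    [t] is bounded by [gcdf_variance_le]. *)
Lemma stein_le_max t w : stein t w <= Num.sqrt (2 * pi) / 4.
Proof.
have max_t : stein t t <= Num.sqrt (2 * pi) / 4.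
  rewrite stein_le// mulrA [_ * gcdf t]mulrC ler_pdivrMr ?gdens_gt0//.
  exact: gcdf_variance_le.
apply: le_trans max_t.
have [wt|/ltW tw] := leP w t.
  rewrite -lerN2.
  apply: (@derive_le0_nincr_except R (- stein t) (fun z => - dstein t z) t w t)
    => // [z|z _ zt|z /andP[_ /ltW zt] _].
  - by apply: continuousN; exact: continuous_stein.
  - by have := is_derive_stein zt => ?; exact: is_deriveN.
  - by rewrite oppr_le0; have /andP[] := dstein_le zt.
apply: (@derive_le0_nincr_except R (stein t) (dstein t) t t w)
  => // [|z _ zt|z /andP[tz _] _].
- exact: continuous_stein.
- exact: is_derive_stein.
- by have /andP[] := dstein_gt tz.
Qed.

(* Subtracting [min w t - gcdf t * w] from the solution leaves a function with
   the Lipschitz derivative [w * stein t w]. *)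
Lemma stein_remainder_le t w a :
  `|stein t w - stein t (w - a) - a * dstein t w| <=
  (`|w| + Num.sqrt (2 * pi) / 4) * a ^+ 2 / 2
  + a * ((w - a <= t)%R%:R - (w <= t)%R%:R).
Proof.
pose m x : R := stein t x - Num.min x t + gcdf t * x.
have cm : continuous m.
  move=> x; apply: cvgD; last by apply: cvgM; [exact: cvg_cst|exact: cvg_id].
  apply: cvgB; first exact: continuous_stein.
  by apply: continuous_min; [exact: cvg_id|exact: cvg_cst].
have dm x : x != t -> is_derive x 1 m (x * stein t x).
  move=> xt.
  have := is_derive_subminD (gcdf t) (is_derive_stein xt) xt.
  by rewrite /dstein; congr is_derive; ring.
have mlip x : `|x * stein t x - w * stein t w| <=
    (`|w| + Num.sqrt (2 * pi) / 4) * `|x - w|.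
  (* The factor [w] is kept at the base point, so the Lipschitz bound of [stein] yields [|w|] and
     its maximum yields [sqrt (2 pi) / 4]. *)
  have -> : x * stein t x - w * stein t w =
      w * (stein t x - stein t w) + (x - w) * stein t x by ring.
  rewrite (le_trans (ler_normD _ _))// [leRHS]mulrDl (normrM w) (normrM (x - w)) lerD//.
    by rewrite ler_wpM2l// stein_lipschitz.
  by rewrite mulrC ler_wpM2r// ger0_norm ?stein_ge0// stein_le_max.
have := first_order_remainder_le (w - a) cm dm mlip.
have -> : w - a - w = - a by ring.
rewrite sqrrN => H.
have -> : stein t w - stein t (w - a) - a * dstein t w =
   - (m (w - a) - m w - - a * (w * stein t w)) +
   (Num.min w t - Num.min (w - a) t - a * (w <= t)%R%:R).
  by rewrite /m /dstein; ring.
rewrite (le_trans (ler_normD _ _))// normrN lerD//.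
(* The [min] part is exactly linear when [w] and [w - a] lie on the same side of [t]; otherwise its
   defect is between 0 and [|a|], which is then the value of the jump term. *)
have [wt|wt] := leP w t; have [wat|wat] := leP (w - a) t;
  rewrite ?mulr1n ?mulr0n ler_norml; apply/andP; split; try lra.
all: nra.
Unshelve. all: by end_near. Qed.

End stein_solution.

(** * Resampling weights *)

Section resampling_weights.
Context {R : realType} {n : nat}.
Implicit Types A B : {set 'I_n}.

Lemma proper_notinT A (j : 'I_n) : j \notin A -> A \proper [set: 'I_n]%SET.
Proof.
by move=> jA; rewrite properT; apply: contraNneq jA => ->; rewrite inE.
Qed.

Lemma sum_proper_notin (F : {set 'I_n} -> 'I_n -> R) :
  \sum_(A : {set 'I_n} | A \proper [set: 'I_n]%SET) \sum_(j | j \notin A) F A j =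
  \sum_j \sum_(A : {set 'I_n} | j \notin A) F A j.
Proof.
rewrite (exchange_big_dep predT)//=; apply: eq_bigr => j _.
apply: eq_bigl => A; case: (boolP (j \notin A)) => jA; last by rewrite andbF.
by rewrite (proper_notinT jA).
Qed.

Lemma sum_notin_cst A (c : R) : \sum_(j | j \notin A) c = c * (n - #|A|)%:R.
Proof.
rewrite (eq_bigl (mem (~: A)%SET)); last by move=> j; rewrite !inE.
by rewrite sumr_const cardsCs finset.setCK card_ord mulr_natr.
Qed.

Lemma kappa_mul A : A \proper [set: 'I_n]%SET ->
  kappa A * (n - #|A|)%:R = ('C(n, #|A|)%:R)^-1 :> R.
Proof.
move=> /proper_card; rewrite cardsT card_ord => An.
have H : (n - #|A|)%:R != 0 :> R by rewrite pnatr_eq0 subn_eq0 -ltnNge.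
by rewrite /kappa natrM invfM divfK.
Qed.

(** By [(k + 1) C(n, k + 1) = (n - k) C(n, k)], the steps that arrive at [A] carry the same total
    weight as those that leave it in [kappa_mul]. This balance is what the definition of [kappa] is
    designed for. *)
Lemma kappa_setD1_mul A (j : 'I_n) : j \in A ->
  kappa (A :\ j)%SET * #|A|%:R = ('C(n, #|A|)%:R)^-1 :> R.
Proof.
move=> jA; have := cardsD1 j A; rewrite jA add1n => cA.
have An : (#|A| <= n)%N by rewrite -[leqRHS]card_ord max_card.
rewrite /kappa mulnC -mul_bin_left -cA natrM invfM mulrC mulrA mulfV ?mul1r//.
by rewrite pnatr_eq0 cA.
Qed.

(* Summing first over the subsets of a given size, this is the telescoping sum
   of the averages of [F] over the subsets of size [k], for [k] from 0 to [n]. *)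
Lemma sum_kappa_telescope (F : {set 'I_n} -> R) : (0 < n)%N ->
  \sum_(A : {set 'I_n} | A \proper [set: 'I_n]%SET)
     \sum_(j | j \notin A) kappa A * (F A - F (j |: A)%SET) =
  F finset.set0 - F [set: 'I_n]%SET.
Proof.
move=> n0; rewrite sum_proper_notin.
have -> : \sum_j \sum_(A : {set 'I_n} | j \notin A)
      kappa A * (F A - F (j |: A)%SET) =
    \sum_(A : {set 'I_n}) \sum_(j | j \notin A) kappa A * F A -
    \sum_(A : {set 'I_n}) \sum_(j | j \in A) kappa (A :\ j)%SET * F A.
  rewrite [X in _ = X - _](exchange_big_dep predT)//=.
  rewrite [X in _ = _ - X](exchange_big_dep predT)//= -sumrB.
  apply: eq_bigr => j _.
  (* The second terms are indexed by the set at which [F] is evaluated, so that all coefficients of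
     one [F A] can be compared. *)
  rewrite [X in _ = _ - X](reindex_onto (fun A => j |: A)%SET (fun A => A :\ j)%SET).
    rewrite [X in _ = _ - X](eq_bigl (fun A => j \notin A)); last first.
      move=> A; rewrite setU11 /=; apply/eqP/idP => [<-|jA].
        by rewrite !inE eqxx.
      by rewrite setU1K.
    rewrite -sumrB; apply: eq_bigr => A jA.
    by rewrite setU1K// mulrBr.
  by move=> A jA; rewrite finset.setD1K.
rewrite -sumrB.
have c1 A : A \proper [set: 'I_n]%SET ->
    \sum_(j | j \notin A) kappa A * F A = F A / 'C(n, #|A|)%:R.
  by move=> AT; rewrite sum_notin_cst mulrAC kappa_mul// mulrC.
have c2 A : A != finset.set0 ->
    \sum_(j | j \in A) kappa (A :\ j)%SET * F A = F A / 'C(n, #|A|)%:R.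
  move=> A0; rewrite -card_gt0 in A0.
  have A0' : #|A|%:R != 0 :> R by rewrite pnatr_eq0 -lt0n.
  rewrite (eq_bigr (fun=> F A / 'C(n, #|A|)%:R / #|A|%:R)).
    by rewrite sumr_const -[LHS]mulr_natr divfK.
  by move=> j jA; rewrite -(kappa_setD1_mul jA); field.
have T0 : [set: 'I_n]%SET != finset.set0 by rewrite -card_gt0 cardsT card_ord.
(* Arrivals and departures cancel at every other set; the empty set has no arrival and the full set
   no departure. *)
rewrite (bigD1 finset.set0)//= (bigD1 [set: 'I_n]%SET)//=.
rewrite [X in _ + (_ + X)]big1 ?addr0; last first.
  by move=> A /andP[A0 AT]; rewrite c1 ?properT// c2// subrr.
rewrite (c1 finset.set0) ?properT 1?eq_sym// (c2 _ T0) finset.cards0 bin0.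
rewrite [X in _ - X + _]big1; last by move=> j; rewrite inE.
rewrite [X in _ + (X - _)]big1; last by move=> j; rewrite inE.
by rewrite cardsT card_ord binn invr1 !mulr1 subr0 sub0r.
Qed.

(** The telescoping identity for the indicator of [j \in A], which changes only when [j] itself is
    added. *)
Lemma sum_kappa_notin (j : 'I_n) :
  \sum_(A : {set 'I_n} | j \notin A) kappa A = 1 :> R.
Proof.
have n0 : (0 < n)%N by apply: leq_ltn_trans (ltn_ord j).
have := sum_kappa_telescope (fun A => (j \in A)%:R) n0.
rewrite !inE sub0r sum_proper_notin (bigD1 j)//= [X in _ + X]big1 ?addr0.
  move=> H; apply: oppr_inj; rewrite -H -sumrN; apply: eq_bigr => A jA.
  by rewrite setU11 (negbTE jA) mulr0n sub0r mulrN mulr1.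
move=> i ij; apply: big1 => A iA.
by rewrite !inE eq_sym (negbTE ij) /= subrr mulr0.
Qed.

End resampling_weights.

(** * Exchangeability *)

Section exchangeability.
Context {R : realType} {dS} {S : measurableType dS} {n : nat}.
Implicit Types (x y : n.-tuple S) (A : {set 'I_n}) (B : 'I_n -> set S).

Definition swap A (z : n.-tuple S * n.-tuple S) : n.-tuple S * n.-tuple S :=
  (resample A z.1 z.2, resample A z.2 z.1).

Lemma tnth_resample A x y i :
  tnth (resample A x y) i = if i \in A then tnth y i else tnth x i.
Proof. by rewrite tnth_mktuple. Qed.

Lemma measurable_resample A :
  measurable_fun setT (fun z : n.-tuple S * n.-tuple S => resample A z.1 z.2).
Proof.
apply/measurable_fun_tnthP => i.
rewrite (_ : _ \o _ = fun z => if i \in A then tnth z.2 i else tnth z.1 i).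
  case: (i \in A).
    by apply: (measurableT_comp (measurable_tnth i)); exact: measurable_snd.
  by apply: (measurableT_comp (measurable_tnth i)); exact: measurable_fst.
by apply/funext => z; rewrite /= tnth_resample.
Qed.

Lemma measurable_resample_swap A : measurable_fun setT (swap A).
Proof.
apply/measurable_fun_pairP; split; first exact: measurable_resample.
have H := @measurable_swap _ _ (n.-tuple S) (n.-tuple S).
exact: (measurableT_comp (measurable_resample A) H).
Qed.

Definition box B B' : set (n.-tuple S * n.-tuple S) :=
  [set z | forall i, B i (tnth z.1 i) /\ B' i (tnth z.2 i)].

(** A family closed under intersection that generates the product sigma-algebra and that every
    [swap A] preserves; equality of laws has to be checked on it only. *)
Definition boxes : set (set (n.-tuple S * n.-tuple S)) :=
  [set C | exists B B', [/\ (forall i, measurable (B i)),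
     (forall i, measurable (B' i)) & C = box B B']].

Lemma boxE B B' : box B B' =
  \bigcap_(i in [set: 'I_n]) ((fun z => tnth z.1 i) @^-1` B i) `&`
  \bigcap_(i in [set: 'I_n]) ((fun z => tnth z.2 i) @^-1` B' i).
Proof.
apply/seteqP; split => z /=; last move=> [].
  by move=> H; split => i _; have [] := H i.
by move=> H1 H2 i; split; [exact: H1|exact: H2].
Qed.

Lemma measurable_tnth_fst i :
  measurable_fun setT (fun z : n.-tuple S * n.-tuple S => tnth z.1 i).
Proof. by apply: (measurableT_comp (measurable_tnth i)); exact: measurable_fst. Qed.

Lemma measurable_tnth_snd i :
  measurable_fun setT (fun z : n.-tuple S * n.-tuple S => tnth z.2 i).
Proof. by apply: (measurableT_comp (measurable_tnth i)); exact: measurable_snd. Qed.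

Lemma measurable_boxes C : boxes C -> measurable (C : set (n.-tuple S * n.-tuple S)%type).
Proof.
move=> [B [B' [mB mB' ->]]]; rewrite boxE; apply: measurableI;
  apply: fin_bigcap_measurable => // i _; rewrite -[X in measurable X]setTI.
  exact: measurable_tnth_fst.
exact: measurable_tnth_snd.
Qed.

(** A condition on a single coordinate is a box whose other sides are full, so all coordinate maps
    are measurable for the sigma-algebra generated by the boxes. *)
Lemma measurable_pair_boxes :
  @measurable _ (n.-tuple S * n.-tuple S)%type = <<s boxes >>.
Proof.
apply/seteqP; split; last first.
  apply: smallest_sub; first exact: sigma_algebra_measurable.
  by move=> C; exact: measurable_boxes.
pose H : measurableType _ := g_sigma_algebraType boxes.
suff mid : measurable_fun [set: H] (fun z : H => z : n.-tuple S * n.-tuple S).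
  by move=> C mC; have := mid measurableT C mC; rewrite setTI.
apply/measurable_fun_pairP; split; apply/measurable_fun_tnthP => i _ Y mY;
  rewrite setTI; apply: sub_sigma_algebra.
- exists (fun k => if k == i then Y else setT), (fun=> setT); split => //.
    by move=> k; case: ifP.
  apply/seteqP; split => z /=; last by move=> /(_ i); rewrite eqxx => -[].
  by move=> Yz k; split => //; case: eqP => // ->.
- exists (fun=> setT), (fun k => if k == i then Y else setT); split => //.
    by move=> k; case: ifP.
  apply/seteqP; split => z /=; last by move=> /(_ i); rewrite eqxx => -[].
  by move=> Yz k; split => //; case: eqP => // ->.
Qed.

Lemma setI_closed_boxes : setI_closed boxes.
Proof.
move=> _ _ [B [B' [mB mB' ->]]] [D [D' [mD mD' ->]]].
exists (fun i => B i `&` D i), (fun i => B' i `&` D' i); split.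
- by move=> i; exact: measurableI.
- by move=> i; exact: measurableI.
- apply/seteqP; split => z /=.
    by move=> [H1 H2] i; have [? ?] := H1 i; have [? ?] := H2 i.
  by move=> H; split => i; have [[? ?] [? ?]] := H i.
Qed.

Lemma preimage_swap_box A B B' : swap A @^-1` box B B' =
  box (fun i => if i \in A then B' i else B i)
      (fun i => if i \in A then B i else B' i).
Proof.
by apply/seteqP; split => z /= H i; have := H i; rewrite !tnth_resample;
  case: ifP => iA //= [].
Qed.

Context {d} {Omega : measurableType d} (P : probability Omega R).
Variables X X' : {RV P >-> n.-tuple S}.
Hypothesis indX : mutual_independence P (fun (i : 'I_n) w => tnth (X w) i).
Hypothesis copyX : independent_copy P X X'.

Let Z w := (X w, X' w).

Lemma measurable_pair_copy : measurable_fun setT Z.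
Proof. by apply: measurable_fun_pair. Qed.

(** The form of the right-hand side matters: each factor is symmetric in [B i] and [B' i], so
    exchanging the two for [i] in [A] leaves it unchanged. *)
Let P_box B B' : (forall i, measurable (B i)) -> (forall i, measurable (B' i)) ->
  P (Z @^-1` box B B') =
  (\prod_(i < n) (P ((fun w => tnth (X w) i) @^-1` B i) *
                  P ((fun w => tnth (X w) i) @^-1` B' i)))%E.
Proof.
move=> mB mB'.
have Pcyl C : (forall i, measurable (C i)) ->
    P (X @^-1` (\bigcap_(i in [set: 'I_n]) (tnth (T:=S) ^~ i @^-1` C i))) =
    (\prod_(i < n) P ((fun w => tnth (X w) i) @^-1` C i))%E.
  move=> mC; have := @indX [set: 'I_n]%SET C (fun i _ => mC i).
  under eq_bigl do rewrite inE.
  move=> <-; congr (P _); apply/seteqP; split => w /=.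
    by move=> H i _; exact: H.
  by move=> H i _; apply: H; rewrite /= inE.
have mcyl C : (forall i, measurable (C i)) ->
    measurable (\bigcap_(i in [set: 'I_n]) (tnth (T:=S) ^~ i @^-1` C i)).
  move=> mC; apply: fin_bigcap_measurable => // i _.
  by rewrite -[X in measurable X]setTI; exact: measurable_tnth.
have [lawX indXX'] := copyX.
rewrite big_split/= -!Pcyl// -(lawX _ (mcyl _ mB')) -indXX'; [|exact: mcyl..].
by rewrite boxE.
Qed.

Let mZA A : measurable_fun setT (swap A \o Z).
Proof. exact: measurableT_comp (measurable_resample_swap A) measurable_pair_copy. Qed.

Let Zrv : {RV P >-> (n.-tuple S * n.-tuple S)%type} :=
  HB.pack Z (isMeasurableFun.Build _ _ _ _ _ measurable_pair_copy).

Let ZArv A : {RV P >-> (n.-tuple S * n.-tuple S)%type} :=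
  HB.pack (swap A \o Z) (isMeasurableFun.Build _ _ _ _ _ (mZA A)).

(** Both laws are finite and agree on the boxes by the symmetry of [P_box]; uniqueness of measures
    extends the equality. *)
Lemma swap_law A C : measurable C ->
  distribution P (ZArv A) C = distribution P Zrv C.
Proof.
move=> mC.
apply: (measure_unique boxes (fun=> setT)) => //.
- exact: measurable_pair_boxes.
- exact: setI_closed_boxes.
- move=> _; exists (fun=> setT), (fun=> setT); split => //.
  by apply/seteqP; split.
- exact: bigcup_const.
- move=> _ [B [B' [mB mB' ->]]].
  rewrite -[LHS]/(P (Z @^-1` (swap A @^-1` box B B'))).
  rewrite -[RHS]/(P (Z @^-1` box B B')).
  rewrite preimage_swap_box !P_box//.
  + by apply: eq_bigr => i _; case: ifP => // _; rewrite muleC.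
  + by move=> i; case: ifP.
  + by move=> i; case: ifP.
- by move=> _; exact: le_lt_trans (probability_le1 _ measurableT) (ltry 1).
Qed.

Lemma ge0_integral_swap A (G : n.-tuple S * n.-tuple S -> \bar R) :
  measurable_fun [set: (n.-tuple S * n.-tuple S)%type] G -> (forall z, 0 <= G z)%E ->
  (\int[P]_w G (swap A (X w, X' w)) = \int[P]_w G (X w, X' w))%E.
Proof.
move=> mG G0.
rewrite -[LHS](ge0_integral_distribution (ZArv A) mG)//.
rewrite -[RHS](ge0_integral_distribution Zrv mG)//.
by apply: eq_measure_integral => C mC _; exact: swap_law.
Qed.

Lemma integrable_swap A (G : n.-tuple S * n.-tuple S -> \bar R) :
  measurable_fun [set: (n.-tuple S * n.-tuple S)%type] G ->
  P.-integrable setT (fun w => G (X w, X' w)) ->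
  P.-integrable setT (fun w => G (swap A (X w, X' w))).
Proof.
move=> mG /integrableP[mGZ GZoo]; apply/integrableP; split.
  exact: measurableT_comp mG (mZA A).
rewrite (@ge0_integral_swap A (fun z => `|G z|)%E)//.
exact: measurableT_comp.
Qed.

Lemma integral_swap A (G : n.-tuple S * n.-tuple S -> \bar R) :
  measurable_fun [set: (n.-tuple S * n.-tuple S)%type] G ->
  P.-integrable setT (fun w => G (X w, X' w)) ->
  (\int[P]_w G (swap A (X w, X' w)) = \int[P]_w G (X w, X' w))%E.
Proof.
move=> mG iG.
have iGA := integrable_swap A mG iG.
rewrite -[LHS](@integral_distribution _ _ _ _ _ _ (ZArv A) _ mG iGA).
rewrite -[RHS](@integral_distribution _ _ _ _ _ _ Zrv _ mG iG).
by apply: eq_measure_integral => C mC _; exact: swap_law.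
Qed.

End exchangeability.

(** * Conditional expectation *)

Section conditional_expectation.
Context {R : realType} {d d'} {Omega : measurableType d} {S : measurableType d'}.
Variables (P : probability Omega R) (X : {RV P >-> S}).

Import HBNNSimple.

(** A simple function is a finite combination of indicators of its level sets, and each contributes
    an integral of [V] over a preimage under [X]. *)
Let centered_nnsfun (V : Omega -> R) (h : {nnsfun S >-> R}) :
  P.-integrable setT (EFin \o V) ->
  (forall B, measurable B -> \int[P]_(w in X @^-1` B) (V w)%:E = 0)%E ->
  (\int[P]_w (V w * h (X w))%:E = 0)%E.
Proof.
move=> iV V0.
pose s : seq R := finmap.enum_fset (fset_set (range h)).
pose B y := X @^-1` (h @^-1` [set y]).
have mB y : measurable (B y).
  rewrite -[B y]setTI; apply: (measurable_funP X) => //.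
transitivity (\int[P]_w \sum_(y <- s) (y%:E * ((V w)%:E * (\1_(B y) w)%:E)))%E.
  apply: eq_integral => w _.
  rewrite fimfunE fsbig_finite//= mulr_sumr -sumEFin.
  by apply: eq_bigr => y _; rewrite -!EFinM mulrCA.
have i1 y : P.-integrable setT (fun w => (V w)%:E * (\1_(B y) w)%:E)%E.
  apply: (le_integrable measurableT _ _ iV).
    apply: emeasurable_funM; first exact: measurable_int _ iV.
    by apply/measurable_EFinP; exact: measurable_indic.
  move=> w _ /=; rewrite lee_fin normrM ler_piMr//.
  by rewrite indicE; case: (_ \in _); rewrite ?normr1 ?normr0.
rewrite integral_sum//; last by move=> y; exact: integrableZl.
apply: big1 => y _; rewrite integralZl//.
rewrite (_ : (fun _ => _) = ((EFin \o V) \_ (B y))); last first.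
  apply/funext => w; rewrite patchE /= indicE.
  by case: (w \in B y); rewrite ?mule1 ?mule0.
by rewrite -integral_mkcond V0 ?mule0//.
Qed.

(** Simple functions increasing to [phi] keep [V * h n] dominated by [V * phi], which is integrable
    by hypothesis even when [phi] is unbounded. *)
Let centered_ge0 (V : Omega -> R) (phi : S -> R) :
  measurable_fun setT phi -> (forall x, 0 <= phi x) ->
  P.-integrable setT (EFin \o V) ->
  P.-integrable setT (fun w => (V w * phi (X w))%:E) ->
  (forall B, measurable B -> \int[P]_(w in X @^-1` B) (V w)%:E = 0)%E ->
  (\int[P]_w (V w * phi (X w))%:E = 0)%E.
Proof.
move=> mphi phi0 iV iVphi V0.
have mphi' : measurable_fun setT (EFin \o phi) by exact/measurable_EFinP.
pose h := nnsfun_approx measurableT mphi'.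
have mV : measurable_fun setT V by apply/measurable_EFinP; exact: measurable_int _ iV.
have mVh n : measurable_fun setT (fun w => (V w * h n (X w))%:E).
  by apply/measurable_EFinP; apply: measurable_funM => //; exact: measurableT_comp.
have hphi x n : h n x <= phi x.
  rewrite -lee_fin /h nnsfun_approxE.
  by apply: (@le_approx _ _ _ setT (EFin \o phi)) => // y _; rewrite lee_fin.
pose F n w := (V w * h n (X w))%:E.
have F0 n : (\int[P]_w F n w = 0)%E by exact: centered_nnsfun.
have [||_ _] := @dominated_convergence _ _ _ P setT measurableT F
  (fun w => (V w * phi (X w))%:E) (fun w => `|(V w * phi (X w))%:E|)%E mVh
  (measurable_int _ iVphi) _ (integrable_abse iVphi).
- apply: aeW => w _; rewrite /F; under eq_fun do rewrite EFinM.
  rewrite EFinM; apply: cvgeZl => //.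
  by apply: (cvg_nnsfun_approx measurableT mphi') => // y _; rewrite lee_fin.
- apply: aeW => w n _; rewrite /F /= lee_fin !normrM ler_wpM2l//.
  by rewrite !ger0_norm.
- under [X in X @ _ --> _]eq_fun do rewrite F0.
  move=> H; apply/esym; apply: (cvg_unique _ (cvg_cst _) H).
  exact: ereal_hausdorff.
Qed.

(** Applied to [Z - Y], with [phi] cut into its positive and negative parts, both dominated by
    [phi]. It serves conditional expectations and, in [Rintegral_copy_mul], the factorisation under
    independence. *)
Lemma integral_mul_of_integral_preimage (Z Y : Omega -> R) (phi : S -> R) :
  measurable_fun setT phi ->
  P.-integrable setT (EFin \o Z) -> P.-integrable setT (EFin \o Y) ->
  P.-integrable setT (EFin \o (fun w => Z w * phi (X w))) ->
  P.-integrable setT (EFin \o (fun w => Y w * phi (X w))) ->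
  (forall B, measurable B -> \int[P]_(w in X @^-1` B) (Y w)%:E =
                             \int[P]_(w in X @^-1` B) (Z w)%:E)%E ->
  \int[P]_w (Z w * phi (X w)) = \int[P]_w (Y w * phi (X w)).
Proof.
move=> mphi iZ iY iZphi iYphi YZ.
pose V w := Z w - Y w.
have iV : P.-integrable setT (EFin \o V).
  exact: (integrableB measurableT iZ iY).
have V0 B : measurable B -> (\int[P]_(w in X @^-1` B) (V w)%:E = 0)%E.
  move=> mB; have mXB : measurable (X @^-1` B).
    by rewrite -[_ @^-1` _]setTI; exact: measurable_funP.
  have iZB := integrableS measurableT mXB (subsetT _) iZ.
  have iYB := integrableS measurableT mXB (subsetT _) iY.
  rewrite /V; under eq_integral do rewrite EFinB.
  rewrite integralB_EFin// YZ// subee//.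
  exact: integrable_fin_num.
have iVphi : P.-integrable setT (EFin \o (fun w => V w * phi (X w))).
  have := integrableB measurableT iZphi iYphi.
  by apply: eq_integrable => // w _; rewrite /V /= mulrBl EFinB.
have part (psi : S -> R) : measurable_fun setT psi -> (forall x, 0 <= psi x) ->
    (forall x, psi x <= `|phi x|) ->
    P.-integrable setT (EFin \o (fun w => V w * psi (X w))) /\
    (\int[P]_w (V w * psi (X w))%:E = 0)%E.
  move=> mpsi psi0 psiphi.
  have ipsi : P.-integrable setT (EFin \o (fun w => V w * psi (X w))).
    apply: (le_integrable measurableT _ _ iVphi).
      apply/measurable_EFinP; apply: measurable_funM.
        by apply/measurable_EFinP; exact: measurable_int iV.
      exact: measurableT_comp.
    by move=> w _ /=; rewrite lee_fin !normrM ler_wpM2l// ger0_norm.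
  by split => //; exact: centered_ge0.
have [|||ip p0] := part (phi^\+).
- exact: measurable_funrpos.
- by move=> x; exact: funrpos_ge0.
- by move=> x; rewrite /funrpos ge_max ler_norm normr_ge0.
have [|||im m0] := part (phi^\-).
- exact: measurable_funrneg.
- by move=> x; exact: funrneg_ge0.
- by move=> x; rewrite /funrneg ge_max -normrN ler_norm normr_ge0.
have Vphi0 : (\int[P]_w (V w * phi (X w))%:E = 0)%E.
  transitivity (\int[P]_w ((V w * phi^\+ (X w))%:E - (V w * phi^\- (X w))%:E))%E.
    apply: eq_integral => w _; rewrite -EFinB -mulrBr.
    by rewrite -[in LHS](funrposBneg phi).
  by rewrite integralB_EFin// p0 m0 sube0.
apply/eqP; rewrite -subr_eq0 -RintegralB//.
rewrite /Rintegral (eq_integral (fun w => (V w * phi (X w))%:E)).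
  by rewrite Vphi0.
by move=> w _; rewrite /V mulrBl.
Qed.

End conditional_expectation.

(** * Moment inequalities *)

Section integral_bounds.
Context {R : realType} {d} {Omega : measurableType d} (P : probability Omega R).
Implicit Types (u v : Omega -> R).

Lemma EFin_Rintegral u : P.-integrable setT (EFin \o u) ->
  (\int[P]_w u w)%:E = (\int[P]_w (u w)%:E)%E.
Proof. by move=> iu; rewrite /Rintegral fineK// integrable_fin_num. Qed.

Lemma measurable_integrableR u :
  P.-integrable setT (EFin \o u) -> measurable_fun setT u.
Proof. by move=> /measurable_int /measurable_EFinP. Qed.

Lemma le_integrableR u v : measurable_fun setT u ->
  (forall w, `|u w| <= `|v w|) ->
  P.-integrable setT (EFin \o v) -> P.-integrable setT (EFin \o u).
Proof.
move=> mu uv; apply: (le_integrable measurableT); first exact/measurable_EFinP.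
by move=> w _; rewrite /= lee_fin.
Qed.

Lemma integrableZR (c : R) u : P.-integrable setT (EFin \o u) ->
  P.-integrable setT (EFin \o (fun w => c * u w)).
Proof. by move=> iu; exact: (integrableZl measurableT c iu). Qed.

Lemma integrableDR u v : P.-integrable setT (EFin \o u) ->
  P.-integrable setT (EFin \o v) -> P.-integrable setT (EFin \o (fun w => u w + v w)).
Proof. by move=> iu iv; exact: (integrableD measurableT iu iv). Qed.

Lemma integrableBR u v : P.-integrable setT (EFin \o u) ->
  P.-integrable setT (EFin \o v) -> P.-integrable setT (EFin \o (fun w => u w - v w)).
Proof. by move=> iu iv; exact: (integrableB measurableT iu iv). Qed.

Lemma integrable_mul_bounded (c : R) u v : P.-integrable setT (EFin \o u) ->
  measurable_fun setT v -> (forall w, `|v w| <= c) ->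
  P.-integrable setT (EFin \o (fun w => u w * v w)).
Proof.
move=> iu mv vc; apply: (@le_integrableR _ (fun w => c * u w)).
- by apply: measurable_funM => //; exact: measurable_integrableR.
- move=> w; rewrite !normrM mulrC ler_wpM2r//.
  by rewrite (le_trans (vc w))// ler_norm.
- exact: integrableZR.
Qed.

Lemma ler_norm_Rintegral_mul u v :
  P.-integrable setT (EFin \o u) -> measurable_fun setT v ->
  (forall w, `|v w| <= 1) ->
  (`|\int[P]_w (u w * v w)|%:E <= \int[P]_w (`|u w|)%:E)%E.
Proof.
move=> iu mv v1; have iuv := integrable_mul_bounded iu mv v1.
have inu : P.-integrable setT (EFin \o (fun w => `|u w|)).
  exact: integrable_norm.
rewrite -(EFin_Rintegral inu) lee_fin (le_trans (le_normr_Rintegral measurableT iuv))//.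
apply: le_Rintegral => //; first exact: integrable_norm.
by move=> w _; rewrite normrM ler_piMr.
Qed.

Lemma integrable_mul_sqr u v : measurable_fun setT u -> measurable_fun setT v ->
  P.-integrable setT (EFin \o (fun w => u w ^+ 2)) ->
  P.-integrable setT (EFin \o (fun w => v w ^+ 2)) ->
  P.-integrable setT (EFin \o (fun w => u w * v w)).
Proof.
move=> mu mv iu iv.
apply: (@le_integrableR _ (fun w => u w ^+ 2 + v w ^+ 2)).
- exact: measurable_funM.
- move=> w; rewrite [leRHS]ger0_norm ?addr_ge0 ?sqr_ge0// normrM.
  rewrite -(real_normK (num_real (u w))) -(real_normK (num_real (v w))).
  have := sqr_ge0 (`|u w| - `|v w|).
  have := normr_ge0 (u w); have := normr_ge0 (v w); nra.
- exact: integrableDR.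
Qed.

Lemma integrable_sqrB u v : measurable_fun setT u -> measurable_fun setT v ->
  P.-integrable setT (EFin \o (fun w => u w ^+ 2)) ->
  P.-integrable setT (EFin \o (fun w => v w ^+ 2)) ->
  P.-integrable setT (EFin \o (fun w => (u w - v w) ^+ 2)).
Proof.
move=> mu mv iu iv.
have := integrableDR (integrableDR iu iv)
  (integrableZR (-2) (integrable_mul_sqr mu mv iu iv)).
by congr (P.-integrable _ _); apply/funext => w /=; congr EFin; ring.
Qed.

Lemma cauchy_schwarz_integral u v :
  measurable_fun setT u -> measurable_fun setT v ->
  (\int[P]_w (`|u w * v w|)%:E <=
   sqrte (\int[P]_w (u w ^+ 2)%:E) * sqrte (\int[P]_w (v w ^+ 2)%:E))%E.
Proof.
move=> mu mv.
have two0 : 0 < 2 :> R by rewrite ltr0n.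
have := @hoelder _ _ _ P u v 2 2 mu mv two0 two0.
have -> : (2^-1 + 2^-1 = 1 :> R) by lra.
move=> /(_ erefl); rewrite Lnorm1 unlock/=.
have sq (z : Omega -> R) :
    (\int[P]_w (`|(z w)%:E| `^ 2) = \int[P]_w (z w ^+ 2)%:E)%E.
  apply: eq_integral => w _.
  by rewrite poweR_EFin powR_mulrn// real_normK// num_real.
by rewrite !sq !poweR12_sqrt//; apply: integral_ge0 => w _; rewrite lee_fin sqr_ge0.
Qed.

Lemma integral_le_sqrt_integral_sqr u : measurable_fun setT u ->
  (\int[P]_w (`|u w|)%:E <= sqrte (\int[P]_w (u w ^+ 2)%:E))%E.
Proof.
move=> mu; have mone : measurable_fun [set: Omega] (fun=> 1 : R) by exact: measurable_cst.
have := cauchy_schwarz_integral mu mone.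
under eq_integral do rewrite /= mulr1.
have -> : (\int[P]_w (1 ^+ 2 : R)%:E = 1)%E.
  by rewrite expr1n integral_cst// mul1e; exact: probability_setT.
by rewrite /sqrte sqrtr1 mule1.
Qed.

(** The Cauchy-Schwarz inequality against the constant 1, in the extended reals so that an infinite
    variance is allowed. *)
Lemma mean_abs_deviation_le u : P.-integrable setT (EFin \o u) ->
  (\int[P]_w (`|u w - \int[P]_w u w|)%:E <= sqrte 'V_P[u])%E.
Proof.
move=> iu; have mu := measurable_integrableR iu.
have -> : 'V_P[u]%E = (\int[P]_w ((u w - \int[P]_w u w) ^+ 2)%:E)%E.
  by rewrite /variance unlock [in LHS]unlock.
by apply: integral_le_sqrt_integral_sqr; exact: measurable_funB.
Qed.

(** Integration of the pointwise inequality [u^2 v <= (2 u^3 + v^3) / 3]; the equality of third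
    moments then merges the two terms. *)
Lemma integral_sqr_mul_le u v :
  measurable_fun setT u -> measurable_fun setT v ->
  (forall w, 0 <= u w) -> (forall w, 0 <= v w) ->
  (\int[P]_w (v w ^+ 3)%:E = \int[P]_w (u w ^+ 3)%:E)%E ->
  (\int[P]_w (u w ^+ 2 * v w)%:E <= \int[P]_w (u w ^+ 3)%:E)%E.
Proof.
move=> mu mv u0 v0 uv.
have mu3 : measurable_fun setT (fun w => u w ^+ 3) by exact: measurable_funX.
have mv3 : measurable_fun setT (fun w => v w ^+ 3) by exact: measurable_funX.
apply: (@le_trans _ _ (\int[P]_w
    ((2 / 3)%:E * (u w ^+ 3)%:E + (1 / 3)%:E * (v w ^+ 3)%:E))%E).
  apply: ge0_le_integral => //.
  - by move=> w _; rewrite lee_fin mulr_ge0// sqr_ge0.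
  - by apply/measurable_EFinP; apply: measurable_funM => //; exact: measurable_funX.
  - by apply: emeasurable_funD; apply: emeasurable_funM => //; exact/measurable_EFinP.
  - move=> w _; rewrite -!EFinM -EFinD lee_fin.
    (* The identity [2 u^3 + v^3 - 3 u^2 v = (u - v)^2 (2 u + v)]. *)
    have := mulr_ge0 (sqr_ge0 (u w - v w)) (addr_ge0 (addr_ge0 (u0 w) (u0 w)) (v0 w)).
    lra.
rewrite ge0_integralD//=.
- rewrite !ge0_integralZl//=.
  + rewrite uv -ge0_muleDl ?lee_fin// -EFinD.
    have -> : 2 / 3 + 1 / 3 = 1 :> R by lra.
    by rewrite mul1e.
  + exact/measurable_EFinP.
  + by move=> w _; rewrite lee_fin exprn_ge0.
  + exact/measurable_EFinP.
  + by move=> w _; rewrite lee_fin exprn_ge0.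
- by move=> w _; rewrite -EFinM lee_fin mulr_ge0 ?exprn_ge0.
- by apply/measurable_EFinP; exact: measurable_funM.
- by move=> w _; rewrite -EFinM lee_fin mulr_ge0 ?exprn_ge0.
- by apply/measurable_EFinP; exact: measurable_funM.
Qed.

End integral_bounds.

(** * Weighted averages over resampled sets *)

Section resampling_average.
Context {R : realType} {n : nat}.
Implicit Types (A : {set 'I_n}) (j : 'I_n) (u v : {set 'I_n} -> 'I_n -> R).

(** The weighting shared by T, T' and the mixed moment terms. Each index [j] receives total weight
    one, so the total mass is [n]. *)
Definition resampling_avg u : R :=
  \sum_(A : {set 'I_n} | A \proper [set: 'I_n]%SET)
    \sum_(j | j \notin A) kappa A * u A j.

(** The default value 0 for [j \in A] gives sums over full finite types, which can be integrated
    term by term. *)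
Lemma resampling_avgE u :
  resampling_avg u =
  \sum_(A : {set 'I_n}) \sum_j if j \notin A then kappa A * u A j else 0.
Proof.
rewrite /resampling_avg sum_proper_notin exchange_big/=; apply: eq_bigr => j _.
exact: big_mkcond.
Qed.

Lemma kappa_ge0 A : 0 <= kappa A :> R.
Proof. by rewrite invr_ge0. Qed.

Lemma eq_resampling_avg u v : (forall A j, j \notin A -> u A j = v A j) ->
  resampling_avg u = resampling_avg v.
Proof. by move=> uv; apply: eq_bigr => A _; apply: eq_bigr => j /uv ->. Qed.

Lemma resampling_avgZ c u :
  resampling_avg (fun A j => c * u A j) = c * resampling_avg u.
Proof.
rewrite mulr_sumr; apply: eq_bigr => A _; rewrite mulr_sumr.
by apply: eq_bigr => j _; rewrite mulrCA.
Qed.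

Lemma resampling_avgD u v :
  resampling_avg (fun A j => u A j + v A j) = resampling_avg u + resampling_avg v.
Proof.
rewrite -big_split/=; apply: eq_bigr => A _; rewrite -big_split/=.
by apply: eq_bigr => j _; rewrite mulrDr.
Qed.

Lemma ler_resampling_avg u v : (forall A j, j \notin A -> u A j <= v A j) ->
  resampling_avg u <= resampling_avg v.
Proof.
move=> uv; apply: ler_sum => A _; apply: ler_sum => j jA.
by rewrite ler_wpM2l ?kappa_ge0// uv.
Qed.

Lemma resampling_avg_ge0 u : (forall A j, j \notin A -> 0 <= u A j) ->
  0 <= resampling_avg u.
Proof.
move=> u0; apply: sumr_ge0 => A _; apply: sumr_ge0 => j jA.
by rewrite mulr_ge0 ?kappa_ge0// u0.
Qed.

Lemma ler_norm_resampling_avg u :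
  `|resampling_avg u| <= resampling_avg (fun A j => `|u A j|).
Proof.
apply: le_trans (ler_norm_sum _ _ _) _; apply: ler_sum => A _.
apply: le_trans (ler_norm_sum _ _ _) _; apply: ler_sum => j _.
by rewrite normrM ger0_norm ?kappa_ge0.
Qed.

Context {d} {Omega : measurableType d} (P : probability Omega R).
Implicit Types U : Omega -> {set 'I_n} -> 'I_n -> R.

Lemma measurable_resampling_avg U :
  (forall A j, j \notin A -> measurable_fun setT (fun w => U w A j)) ->
  measurable_fun setT (fun w => resampling_avg (U w)).
Proof.
move=> mU; rewrite (funext (fun w => resampling_avgE (U w))).
apply: measurable_sum => A; apply: measurable_sum => j; case jA: (j \notin A) => //.
by apply: measurable_funM => //; exact: mU.
Qed.

Let resampling_avg_EFin u : (resampling_avg u)%:E =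
  (\sum_(A : {set 'I_n}) \sum_j
    (if j \notin A then kappa A * u A j else 0)%:E)%E.
Proof. by rewrite resampling_avgE -sumEFin; under eq_bigr do rewrite -sumEFin. Qed.

Let integrable_summand U A j :
  (forall A j, j \notin A -> P.-integrable setT (EFin \o (fun w => U w A j))) ->
  P.-integrable setT
    (fun w => (if j \notin A then kappa A * U w A j else 0)%:E).
Proof.
move=> iU; case jA: (j \notin A); last exact: integrable0.
exact/integrableZR/iU.
Qed.

Lemma integrable_resampling_avg U :
  (forall A j, j \notin A -> P.-integrable setT (EFin \o (fun w => U w A j))) ->
  P.-integrable setT (EFin \o (fun w => resampling_avg (U w))).
Proof.
move=> iU; rewrite -[X in P.-integrable _ X]/(fun w => (resampling_avg (U w))%:E).
rewrite (funext (fun w => resampling_avg_EFin (U w))).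
apply: integrable_sum => // A _; apply: integrable_sum => // j _.
exact: integrable_summand.
Qed.

Lemma Rintegral_resampling_avg U :
  (forall A j, j \notin A -> P.-integrable setT (EFin \o (fun w => U w A j))) ->
  \int[P]_w resampling_avg (U w) = resampling_avg (fun A j => \int[P]_w U w A j).
Proof.
move=> iU; apply: EFin_inj; rewrite EFin_Rintegral; last exact: integrable_resampling_avg.
under eq_integral do rewrite resampling_avg_EFin.
rewrite integral_sum//; last first.
  by move=> A; apply: integrable_sum => // j _; exact: integrable_summand.
rewrite resampling_avg_EFin; apply: eq_bigr => A _.
rewrite integral_sum//; last by move=> j; exact: integrable_summand.
apply: eq_bigr => j _; case jA: (j \notin A); last by rewrite integral0.
by rewrite -RintegralZl ?EFin_Rintegral//; [exact/integrableZR/iU|exact: iU].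
Qed.

(* The weights of the sets avoiding a given index add up to one. *)
Lemma integral_resampling_avg_le U (c : 'I_n -> \bar R) :
  (forall j, 0 <= c j)%E ->
  (forall A j, j \notin A -> measurable_fun setT (fun w => U w A j)) ->
  (forall w A j, j \notin A -> 0 <= U w A j) ->
  (forall A j, j \notin A -> \int[P]_w (U w A j)%:E <= c j)%E ->
  (\int[P]_w (resampling_avg (U w))%:E <= \sum_(j < n) c j)%E.
Proof.
move=> c0 mU U0 Uc.
pose V w A j : R := if j \notin A then kappa A * U w A j else 0.
have V0 w A j : 0 <= V w A j.
  by rewrite /V; case: ifP => // jA; rewrite mulr_ge0 ?kappa_ge0// U0.
have mV A j : measurable_fun setT (fun w => (V w A j)%:E).
  apply/measurable_EFinP; rewrite /V; case jA: (j \notin A) => //.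
  by apply: measurable_funM => //; exact: mU.
under eq_integral do rewrite resampling_avg_EFin exchange_big/=.
rewrite (@ge0_integral_sum _ _ _ _ _ _ _ (fun j w => \sum_A (V w A j)%:E)%E)//=; last 2 first.
- by move=> j; exact: emeasurable_sum.
- by move=> j w _; apply: sume_ge0 => A _; rewrite lee_fin.
apply: lee_sum => j _.
rewrite (@ge0_integral_sum _ _ _ _ _ _ _ (fun A w => (V w A j)%:E))//=; last first.
  by move=> A w _; rewrite lee_fin.
rewrite -[leRHS]mul1e -(@sum_kappa_notin R n j) -sumEFin ge0_sume_distrl; last first.
  by move=> A _; rewrite lee_fin kappa_ge0.
rewrite [leRHS]big_mkcond/=; apply: lee_sum => A _; rewrite /V.
case jA: (j \notin A); last by rewrite integral0.
under eq_integral do rewrite EFinM.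
rewrite ge0_integralZl//.
- by apply: lee_wpmul2l; rewrite ?lee_fin ?kappa_ge0// Uc.
- by apply/measurable_EFinP; exact: mU.
- by move=> w _; rewrite lee_fin U0.
- by rewrite lee_fin kappa_ge0.
Qed.

End resampling_average.

(** * Covariance formulas *)

Section resampled_function.
Context {R : realType} {dS} {S : measurableType dS} {n : nat}.
Implicit Types (x y : n.-tuple S) (z : n.-tuple S * n.-tuple S).
Implicit Types (A : {set 'I_n}) (j : 'I_n).
Variable f : n.-tuple S -> R.

(** Every increment of [f] is a difference of two such values, and swapping coordinates of the pair
    acts on the index set alone: a swap at [j] toggles the membership of [j]. *)
Definition fresample A z : R := f (resample A z.1 z.2).

Lemma resample0 x y : resample finset.set0 x y = x.
Proof. by apply: eq_from_tnth => i; rewrite tnth_resample inE. Qed.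

Lemma resampleT x y : resample [set: 'I_n]%SET x y = y.
Proof. by apply: eq_from_tnth => i; rewrite tnth_resample inE. Qed.

Lemma DeltaE j z :
  Delta f j z.1 z.2 = fresample finset.set0 z - fresample [set j]%SET z.
Proof. by rewrite /fresample resample0. Qed.

Lemma Delta_resampleE A j z :
  Delta f j (resample A z.1 z.2) z.2 = fresample A z - fresample (j |: A)%SET z.
Proof.
rewrite /Delta /fresample; congr (_ - f _).
by apply: eq_from_tnth => i; rewrite !tnth_resample !inE; case: (i == j).
Qed.

Lemma fresample_swap1 A j z : j \notin A ->
  fresample A (swap [set j]%SET z) = fresample (j |: A)%SET z.
Proof.
move=> jA; congr f; apply: eq_from_tnth => i; rewrite !tnth_resample !inE.
by have [->|_] := eqVneq i j; [rewrite (negbTE jA)|case: ifP].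
Qed.

Lemma fresample_swap1U A j z : j \notin A ->
  fresample (j |: A)%SET (swap [set j]%SET z) = fresample A z.
Proof.
move=> jA; congr f; apply: eq_from_tnth => i; rewrite !tnth_resample !inE.
by have [->|_] := eqVneq i j; [rewrite (negbTE jA)|case: ifP].
Qed.

Lemma fresample0_swap A z : fresample finset.set0 (swap A z) = fresample A z.
Proof. by rewrite /fresample resample0. Qed.

Lemma fresample1_swap A j z : j \notin A ->
  fresample [set j]%SET (swap A z) = fresample (j |: A)%SET z.
Proof.
move=> jA; congr f; apply: eq_from_tnth => i; rewrite !tnth_resample !inE.
by have [->|_] := eqVneq i j; [rewrite (negbTE jA)|].
Qed.

Lemma fresample1_swap1 j z :
  fresample [set j]%SET (swap [set j]%SET z) = fresample finset.set0 z.
Proof.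
by have := @fresample_swap1U finset.set0 j z; rewrite finset.setU0 inE => ->.
Qed.

Lemma TsumE z : Tsum f z.1 z.2 = 2^-1 * resampling_avg (fun A j =>
  (fresample finset.set0 z - fresample [set j]%SET z) *
  (fresample A z - fresample (j |: A)%SET z)).
Proof.
congr (_ * _); apply: eq_bigr => A _; rewrite mulr_sumr.
by apply: eq_bigr => j _; rewrite DeltaE Delta_resampleE.
Qed.

Lemma Tsum'E z : Tsum' f z.1 z.2 = 2^-1 * resampling_avg (fun A j =>
  (fresample finset.set0 z - fresample [set j]%SET z) *
  `|fresample A z - fresample (j |: A)%SET z|).
Proof.
congr (_ * _); apply: eq_bigr => A _; rewrite mulr_sumr.
by apply: eq_bigr => j _; rewrite DeltaE Delta_resampleE.
Qed.

Hypothesis mf : measurable_fun setT f.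

Lemma measurable_fresample A : measurable_fun setT (fresample A).
Proof. exact: (measurableT_comp mf (measurable_resample A)). Qed.

Context {d} {Omega : measurableType d} (P : probability Omega R).
Variables X X' : {RV P >-> n.-tuple S}.
Hypothesis indX : mutual_independence P (fun (i : 'I_n) w => tnth (X w) i).
Hypothesis copyX : independent_copy P X X'.

Let Z w := (X w, X' w).
Let F A w := fresample A (Z w).

Lemma measurable_fresample_pair A : measurable_fun setT (F A).
Proof. exact: (measurableT_comp (measurable_fresample A) (measurable_pair_copy X X')). Qed.

Let mF := measurable_fresample_pair.

Let F0E w : F finset.set0 w = f (X w).
Proof. by rewrite /F /fresample resample0. Qed.

(** Swapping the coordinates in [A] carries the increment at X to the increment at X^A, so the two
    have the same law. *)
Lemma integral_Delta_resample_exp k A j : j \notin A ->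
  (\int[P]_w (`|F A w - F (j |: A)%SET w| ^+ k)%:E =
   \int[P]_w (`|F finset.set0 w - F [set j]%SET w| ^+ k)%:E)%E.
Proof.
move=> jA.
pose G z := (`|fresample finset.set0 z - fresample [set j]%SET z| ^+ k)%:E.
have mG : measurable_fun setT G.
  apply/measurable_EFinP; apply: measurable_funX.
  apply: (measurableT_comp (@normr_measurable R setT)).
  by apply: measurable_funB; exact: measurable_fresample.
rewrite -(ge0_integral_swap indX copyX A mG).
  by apply: eq_integral => w _; rewrite /G fresample0_swap fresample1_swap.
by move=> z; rewrite lee_fin exprn_ge0.
Qed.

Hypothesis if2 : P.-integrable setT (EFin \o (fun w => f (X w) ^+ 2)).

Lemma integrable_fresample_sqr A : P.-integrable setT (EFin \o (fun w => F A w ^+ 2)).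
Proof.
pose G z := (fresample finset.set0 z ^+ 2)%:E.
have mG : measurable_fun setT G.
  by apply/measurable_EFinP; apply: measurable_funX; exact: measurable_fresample.
have iG : P.-integrable setT (fun w => G (X w, X' w)).
  by move: if2; congr (P.-integrable _ _); apply/funext => w; rewrite /= -F0E.
have := integrable_swap indX copyX A mG iG.
by congr (P.-integrable _ _); apply/funext => w; rewrite /G fresample0_swap.
Qed.

Lemma integrable_fresample A : P.-integrable setT (EFin \o F A).
Proof.
have i1 : P.-integrable setT (EFin \o (fun _ : Omega => (1 : R) ^+ 2)).
  exact: finite_measure_integrable_cst.
have := integrable_mul_sqr (mF A) (@measurable_cst _ _ _ _ _ _)
  (integrable_fresample_sqr A) i1.
by under eq_fun do rewrite mulr1.
Qed.

Lemma integrable_fresampleB_mul A B A' B' : P.-integrable setT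
  (EFin \o (fun w => (F A w - F B w) * (F A' w - F B' w))).
Proof.
apply: integrable_mul_sqr; try exact: measurable_funB.
  by apply: integrable_sqrB => //; exact: integrable_fresample_sqr.
by apply: integrable_sqrB => //; exact: integrable_fresample_sqr.
Qed.

Lemma Rintegral_swap A (G : n.-tuple S * n.-tuple S -> R) :
  measurable_fun setT G -> P.-integrable setT (EFin \o (fun w => G (Z w))) ->
  \int[P]_w G (swap A (Z w)) = \int[P]_w G (Z w).
Proof.
move=> mG iG; congr fine.
apply: (integral_swap indX copyX A (G := EFin \o G)) => //.
exact/measurable_EFinP.
Qed.

(** * Covariance of f(X) with a square-integrable function of f(X) *)

Section test_function.
Variable k : R -> R.
Hypothesis mk : measurable_fun setT k.
Hypothesis ik2 : P.-integrable setT (EFin \o (fun w => k (F finset.set0 w) ^+ 2)).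

Let mkF A : measurable_fun setT (fun w => k (F A w)).
Proof. exact: measurableT_comp. Qed.

Let integrable_k_fresample_sqr A :
  P.-integrable setT (EFin \o (fun w => k (F A w) ^+ 2)).
Proof.
pose G z := (k (fresample finset.set0 z) ^+ 2)%:E.
have mG : measurable_fun setT G.
  apply/measurable_EFinP; apply: measurable_funX.
  by apply: measurableT_comp => //; exact: measurable_fresample.
have := integrable_swap indX copyX A mG ik2.
by congr (P.-integrable _ _); apply/funext => w; rewrite /G fresample0_swap.
Qed.

Lemma integrable_k_fresample_mul B A A' :
  P.-integrable setT (EFin \o (fun w => k (F B w) * (F A w - F A' w))).
Proof.
apply: integrable_mul_sqr => //; first exact: measurable_funB.
by apply: integrable_sqrB => //; exact: integrable_fresample_sqr.
Qed.

(** The swap at [j] reverses the sign of the increment and moves [k] from f(X) to f(X^j), so the two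
    halves of the difference contribute equally. *)
Lemma Rintegral_Delta_mul A j : j \notin A ->
  \int[P]_w ((k (F finset.set0 w) - k (F [set j]%SET w)) *
             (F A w - F (j |: A)%SET w)) =
  2 * \int[P]_w (k (F finset.set0 w) * (F A w - F (j |: A)%SET w)).
Proof.
move=> jA.
pose G z := k (fresample finset.set0 z) *
  (fresample A z - fresample (j |: A)%SET z).
have mG : measurable_fun setT G.
  apply: measurable_funM.
    by apply: measurableT_comp => //; exact: measurable_fresample.
  by apply: measurable_funB; exact: measurable_fresample.
have iG B := integrable_k_fresample_mul B A (j |: A)%SET.
have := Rintegral_swap [set j]%SET mG (iG finset.set0).
rewrite (@eq_Rintegral _ _ _ _ _ (fun w =>
  -1 * (k (F [set j]%SET w) * (F A w - F (j |: A)%SET w)))); last first.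
  move=> w _; rewrite /G fresample0_swap fresample_swap1// fresample_swap1U//.
  by rewrite /F; ring.
rewrite RintegralZl//.
move=> H; under eq_Rintegral do rewrite mulrBl.
rewrite RintegralB//.
have HG : \int[P]_w G (Z w) =
    \int[P]_w (k (F finset.set0 w) * (F A w - F (j |: A)%SET w)) by [].
lra.
Qed.

Hypothesis EF0 : \int[P]_w f (X w) = 0.

Let ifX : P.-integrable setT (EFin \o (fun w => f (X w))).
Proof.
have := integrable_fresample finset.set0.
by congr (P.-integrable _ _); apply/funext => w /=; rewrite F0E.
Qed.

Let FTE w : F [set: 'I_n]%SET w = f (X' w).
Proof. by rewrite /F /fresample resampleT. Qed.

Let ifX' : P.-integrable setT (EFin \o (fun w => f (X' w))).
Proof.
have := integrable_fresample [set: 'I_n]%SET.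
by congr (P.-integrable _ _); apply/funext => w /=; rewrite FTE.
Qed.

Let ifX'2 : P.-integrable setT (EFin \o (fun w => f (X' w) ^+ 2)).
Proof.
have := integrable_fresample_sqr [set: 'I_n]%SET.
by congr (P.-integrable _ _); apply/funext => w /=; rewrite FTE.
Qed.

(** Independence is used through conditioning, in two stages, so that no product measure is
    needed. *)
Lemma Rintegral_copy_mul : \int[P]_w (k (f (X w)) * f (X' w)) = 0.
Proof.
have EfX' : \int[P]_w f (X' w) = 0.
  rewrite -EF0.
  have := Rintegral_swap [set: 'I_n]%SET (measurable_fresample finset.set0)
     (integrable_fresample finset.set0).
  under eq_Rintegral do rewrite fresample0_swap -[fresample _ _]/(F _ _) FTE.
  by under [RHS]eq_Rintegral do rewrite -[fresample _ _]/(F _ _) F0E.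
have [lawX indXX'] := copyX.
have mX B : measurable B -> measurable (X @^-1` B).
  by move=> mB; rewrite -[_ @^-1` _]setTI; exact: measurable_funP.
have mX' B : measurable B -> measurable (X' @^-1` B).
  by move=> mB; rewrite -[_ @^-1` _]setTI; exact: measurable_funP.
(* Given X', the indicator of the event that X lies in [B] has constant conditional expectation [c];
   pairing it with f(X') gives [c] times the mean of f(X'). *)
have condX' B : measurable B ->
    \int[P]_w (\1_(X @^-1` B) w * f (X' w)) = 0.
  move=> mB; pose c := fine (P (X @^-1` B)).
  have i1 : P.-integrable setT (EFin \o \1_(X @^-1` B)).
    by apply: integrable_indic => //; exact: mX.
  have ic : P.-integrable setT (EFin \o (fun _ : Omega => c)).
    exact: finite_measure_integrable_cst.
  transitivity (\int[P]_w (c * f (X' w))).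
    apply: integral_mul_of_integral_preimage => //.
    - apply: (le_integrableR _ _ ifX').
        apply: measurable_funM; first exact/measurable_indic/mX.
        exact: measurable_integrableR ifX'.
      move=> w; rewrite normrM ler_piMl//.
      by rewrite indicE; case: (_ \in _); rewrite ?normr1 ?normr0.
    - exact: integrableZR.
    - move=> C mC; have mXB := mX _ mB; have mXC := mX' _ mC.
      rewrite integral_cst// integral_indic//.
      by rewrite fineK ?fin_num_measure// -indXX'.
  by rewrite RintegralZl// EfX' mulr0.
have ikX : P.-integrable setT (EFin \o (fun w => k (f (X w)) ^+ 2)).
  by move: ik2; congr (P.-integrable _ _); apply/funext => w; rewrite /= F0E.
have mfX : measurable_fun setT (fun w => k (f (X w))).
  by apply: measurableT_comp => //; exact: measurable_integrableR ifX.
have mfX' := measurable_integrableR ifX'.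
transitivity (\int[P]_w (f (X' w) * k (f (X w)))).
  by under eq_Rintegral do rewrite mulrC.
(* The previous stage says that f(X') has conditional expectation 0 given X. *)
have -> : \int[P]_w (f (X' w) * k (f (X w))) = \int[P]_w (0 * k (f (X w))).
  apply: (integral_mul_of_integral_preimage (phi := fun x => k (f x))) => //.
  - exact: measurableT_comp.
  - exact: integrable0.
  - exact: integrable_mul_sqr.
  - by under eq_fun do rewrite mul0r; exact: integrable0.
  - move=> B mB; rewrite integral0.
    have := condX' B mB; rewrite /Rintegral => H.
    have mXB := mX _ mB.
    rewrite integral_mkcond/=.
    have -> : ((fun w => (f (X' w))%:E) \_ (X @^-1` B)) =
        (fun w => (\1_(X @^-1` B) w * f (X' w))%:E).
      apply/funext => w; rewrite patchE indicE.
      by case: (w \in _); rewrite ?mul1r ?mul0r.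
    rewrite -EFin_Rintegral ?condX'//.
    apply: (le_integrableR _ _ ifX').
      by apply: measurable_funM => //; exact: measurable_indic.
    move=> w; rewrite normrM ler_piMl//.
    by rewrite indicE; case: (_ \in _); rewrite ?normr1 ?normr0.
by under eq_Rintegral do rewrite mul0r; rewrite /Rintegral integral0.
Qed.

Lemma Rintegral_mul_self : (0 < n)%N ->
  \int[P]_w (k (f (X w)) * f (X w)) =
  2^-1 * \int[P]_w resampling_avg (fun A j =>
    (k (F finset.set0 w) - k (F [set j]%SET w)) * (F A w - F (j |: A)%SET w)).
Proof.
move=> n0.
rewrite Rintegral_resampling_avg; last first.
  move=> A j _.
  have := integrableBR (integrable_k_fresample_mul finset.set0 A (j |: A)%SET)
    (integrable_k_fresample_mul [set j]%SET A (j |: A)%SET).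
  by congr (P.-integrable _ _); apply/funext => w /=; rewrite mulrBl.
rewrite (eq_resampling_avg (v := fun A j =>
  2 * \int[P]_w (k (F finset.set0 w) * (F A w - F (j |: A)%SET w)))); last first.
  by move=> A j; exact: Rintegral_Delta_mul.
rewrite resampling_avgZ mulrA mulVf ?mul1r ?pnatr_eq0//.
rewrite -(Rintegral_resampling_avg (U := fun w A j =>
  k (F finset.set0 w) * (F A w - F (j |: A)%SET w))); last first.
  by move=> A j _; exact: integrable_k_fresample_mul.
transitivity (\int[P]_w (k (F finset.set0 w) *
    (F finset.set0 w - F [set: 'I_n]%SET w))); last first.
  apply: eq_Rintegral => w _.
  rewrite resampling_avgZ; congr (_ * _).
  by rewrite -(sum_kappa_telescope (fun A => F A w) n0).
(* Subtracting the vanishing cross term turns f(X) into f(X) - f(X'), the total of the telescoping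
   sum. *)
rewrite -[LHS]subr0 -Rintegral_copy_mul -RintegralB//.
- apply: eq_Rintegral => w _; rewrite -mulrBr F0E.
  by congr (_ * (_ - _)); rewrite /F /fresample resampleT.
- apply: integrable_mul_sqr.
  + by apply: measurableT_comp => //; exact: measurable_integrableR ifX.
  + exact: measurable_integrableR ifX.
  + by move: ik2; congr (P.-integrable _ _); apply/funext => w; rewrite /= F0E.
  + exact: if2.
- apply: integrable_mul_sqr.
  + by apply: measurableT_comp => //; exact: measurable_integrableR ifX.
  + exact: measurable_integrableR ifX'.
  + by move: ik2; congr (P.-integrable _ _); apply/funext => w; rewrite /= F0E.
  + exact: ifX'2.
Qed.

End test_function.

Lemma integrable_Tsum :
  P.-integrable setT (EFin \o (fun w => Tsum f (X w) (X' w))).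
Proof.
have := integrableZR 2^-1 (integrable_resampling_avg (P := P)
  (fun A j _ => integrable_fresampleB_mul finset.set0 [set j]%SET A (j |: A)%SET)).
by congr (P.-integrable _ _); apply/funext => w /=; rewrite -(TsumE (Z w)).
Qed.

Lemma integrable_fresampleB_mul_norm A B A' B' : P.-integrable setT
  (EFin \o (fun w => (F A w - F B w) * `|F A' w - F B' w|)).
Proof.
apply: le_integrableR (integrable_fresampleB_mul A B A' B').
  apply: measurable_funM; first exact: measurable_funB.
  by apply: (measurableT_comp (@normr_measurable R setT)); exact: measurable_funB.
by move=> w; rewrite !normrM normr_id.
Qed.

Lemma integrable_Tsum' :
  P.-integrable setT (EFin \o (fun w => Tsum' f (X w) (X' w))).
Proof.
have := integrableZR 2^-1 (integrable_resampling_avg (P := P)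
  (fun A j _ => integrable_fresampleB_mul_norm finset.set0 [set j]%SET A (j |: A)%SET)).
by congr (P.-integrable _ _); apply/funext => w /=; rewrite -(Tsum'E (Z w)).
Qed.

(** The covariance formula with the identity as test function. *)
Lemma Rintegral_Tsum (s : R) : (0 < n)%N -> \int[P]_w f (X w) = 0 ->
  \int[P]_w (f (X w) ^+ 2) = s -> \int[P]_w Tsum f (X w) (X' w) = s.
Proof.
move=> n0 EF0 <-.
have iF0 := integrable_fresample_sqr finset.set0.
have := Rintegral_mul_self (@measurable_id _ _ setT) iF0 EF0 n0.
under eq_Rintegral do rewrite -expr2.
move=> ->; rewrite -RintegralZl//.
  by apply: eq_Rintegral => w _; rewrite -(TsumE (Z w)).
apply: integrable_resampling_avg => A j _; exact: integrable_fresampleB_mul.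
Qed.

(** * Antisymmetry of T' and bounded test functions *)

Section bounded_test_function.
Variables (h : R -> R) (c : R).
Hypotheses (mh : measurable_fun setT h) (hc : forall r, `|h r| <= c).

Let mhF A : measurable_fun setT (fun w => h (F A w)).
Proof. exact: measurableT_comp. Qed.

Let ihF A B A' B' C : P.-integrable setT
  (EFin \o (fun w => (F A w - F B w) * `|F A' w - F B' w| * h (F C w))).
Proof.
exact: integrable_mul_bounded (integrable_fresampleB_mul_norm A B A' B') (mhF C) _.
Qed.

(** The swap at [j] reverses the first increment, fixes the absolute value of the second and
    exchanges the arguments of [h]. *)
Lemma Rintegral_Delta_norm_mul A j : j \notin A ->
  \int[P]_w ((F finset.set0 w - F [set j]%SET w) *
     `|F A w - F (j |: A)%SET w| * (h (F [set j]%SET w) - h (F finset.set0 w))) =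
  -2 * \int[P]_w ((F finset.set0 w - F [set j]%SET w) *
     `|F A w - F (j |: A)%SET w| * h (F finset.set0 w)).
Proof.
move=> jA.
pose G z := (fresample finset.set0 z - fresample [set j]%SET z) *
  `|fresample A z - fresample (j |: A)%SET z| * h (fresample finset.set0 z).
have mG : measurable_fun setT G.
  apply: measurable_funM; last first.
    by apply: measurableT_comp => //; exact: measurable_fresample.
  apply: measurable_funM; first by apply: measurable_funB; exact: measurable_fresample.
  apply: (measurableT_comp (@normr_measurable R setT)).
  by apply: measurable_funB; exact: measurable_fresample.
have i0 := ihF finset.set0 [set j]%SET A (j |: A)%SET finset.set0.
have i1 := ihF finset.set0 [set j]%SET A (j |: A)%SET [set j]%SET.
have := Rintegral_swap [set j]%SET mG i0.
rewrite (@eq_Rintegral _ _ _ _ _ (fun w => -1 *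
    ((F finset.set0 w - F [set j]%SET w) *
     `|F A w - F (j |: A)%SET w| * h (F [set j]%SET w)))); last first.
  move=> w _; rewrite /G fresample0_swap fresample1_swap1.
  rewrite fresample_swap1// fresample_swap1U// distrC.
  by rewrite /F; ring.
rewrite RintegralZl//.
move=> H; under eq_Rintegral do rewrite mulrBr.
rewrite RintegralB//.
have HG : \int[P]_w G (Z w) = \int[P]_w ((F finset.set0 w - F [set j]%SET w) *
  `|F A w - F (j |: A)%SET w| * h (F finset.set0 w)) by [].
lra.
Qed.

(** The constant is the [-2] of each summand times the 2 that undoes the factor one half in T'. *)
Lemma Rintegral_resampling_avg_Delta_norm :
  \int[P]_w resampling_avg (fun A j => (F finset.set0 w - F [set j]%SET w) *
     `|F A w - F (j |: A)%SET w| * (h (F [set j]%SET w) - h (F finset.set0 w))) =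
  -4 * \int[P]_w (Tsum' f (X w) (X' w) * h (f (X w))).
Proof.
rewrite Rintegral_resampling_avg; last first.
  move=> A j _.
  have := integrableBR (ihF finset.set0 [set j]%SET A (j |: A)%SET [set j]%SET)
    (ihF finset.set0 [set j]%SET A (j |: A)%SET finset.set0).
  by congr (P.-integrable _ _); apply/funext => w /=; rewrite mulrBr.
rewrite (eq_resampling_avg Rintegral_Delta_norm_mul) resampling_avgZ.
rewrite -(Rintegral_resampling_avg (U := fun w A j =>
  (F finset.set0 w - F [set j]%SET w) * `|F A w - F (j |: A)%SET w| *
  h (F finset.set0 w))); last by move=> A j _; exact: ihF.
have -> : -4 = -2 * 2 :> R by ring.
rewrite -mulrA; congr (_ * _); rewrite -RintegralZl//; last first.
  apply: (integrable_mul_bounded (c := c)) => //; first exact: integrable_Tsum'.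
  by have := mhF finset.set0; under eq_fun do rewrite F0E.
apply: eq_Rintegral => w _.
rewrite (Tsum'E (Z w)) !mulrA divff ?mul1r ?pnatr_eq0// -F0E mulrC -resampling_avgZ.
by apply: eq_resampling_avg => A j _; rewrite mulrC.
Qed.

End bounded_test_function.

(** With the constant test function 1 the left side of the preceding identity vanishes. *)
Lemma Rintegral_Tsum' : \int[P]_w Tsum' f (X w) (X' w) = 0.
Proof.
have one1 (x : R) : `|(1 : R)| <= 1 by rewrite normr1.
have := @Rintegral_resampling_avg_Delta_norm (fun=> 1) 1
  (@measurable_cst _ _ _ _ setT (1 : R)) one1.
under eq_Rintegral.
  move=> w _; rewrite (eq_resampling_avg (v := fun _ _ => 0 * 0)).
    rewrite resampling_avgZ mul0r; over.
  by move=> A j _; rewrite subrr mulr0 mul0r.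
under [X in _ = _ * X]eq_Rintegral do rewrite mulr1.
by move=> {one1}; rewrite /Rintegral integral0/=; lra.
Qed.

End resampled_function.

(** * Normal approximation *)

Section stein_bound.
Context {R : realType} {dS} {S : measurableType dS} {n : nat}.
Implicit Types (A : {set 'I_n}) (j : 'I_n).
Context {d} {Omega : measurableType d} (P : probability Omega R).
Variables (X X' : {RV P >-> n.-tuple S}) (f : n.-tuple S -> R) (sigma : R).
Variables (ET ET' : Omega -> R).
Hypotheses (n0 : (0 < n)%N) (mf : measurable_fun setT f).
Hypothesis indX : mutual_independence P (fun (i : 'I_n) w => tnth (X w) i).
Hypothesis copyX : independent_copy P X X'.
Hypothesis if2 : P.-integrable setT (EFin \o (fun w => f (X w) ^+ 2)).
Hypothesis EF0 : \int[P]_w f (X w) = 0.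
Hypothesis sigma0 : 0 < sigma.
Hypothesis EF2 : \int[P]_w (f (X w) ^+ 2) = sigma ^+ 2.
Hypothesis condT : is_cond_expectation P X (fun w => Tsum f (X w) (X' w)) ET.
Hypothesis condT' : is_cond_expectation P X (fun w => Tsum' f (X w) (X' w)) ET'.

Let F A w := fresample f A (X w, X' w).
Let D j w := F finset.set0 w - F [set j]%SET w.
Let DA A j w := F A w - F (j |: A)%SET w.

Let mF A : measurable_fun setT (F A).
Proof. exact: measurable_fresample_pair. Qed.

Let F0E w : F finset.set0 w = f (X w).
Proof. by rewrite /F /fresample resample0. Qed.

Let mfX : measurable_fun setT (fun w => f (X w)).
Proof. by have := mF finset.set0; rewrite (funext F0E). Qed.

Lemma Rintegral_cond_mul (Z Y : Omega -> R) (phi : R -> R) (c : R) :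
  is_cond_expectation P X Z Y -> P.-integrable setT (EFin \o Z) ->
  measurable_fun setT phi -> (forall r, `|phi r| <= c) ->
  \int[P]_w (Z w * phi (f (X w))) = \int[P]_w (Y w * phi (f (X w))).
Proof.
move=> [_ iY ZY] iZ mphi phic.
have mphiX : measurable_fun setT (fun w => phi (f (X w))).
  exact: (measurableT_comp mphi mfX).
apply: (integral_mul_of_integral_preimage (phi := fun x => phi (f x))) => //.
- exact: measurableT_comp.
- exact: integrable_mul_bounded iZ mphiX _.
- exact: integrable_mul_bounded iY mphiX _.
- by move=> B mB; apply: ZY; exists B => //; rewrite setTI.
Qed.

Lemma Rintegral_cond (Z Y : Omega -> R) : is_cond_expectation P X Z Y ->
  \int[P]_w Z w = \int[P]_w Y w.
Proof.
move=> [_ _ ZY]; congr fine; apply/esym/ZY.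
by exists setT => //; rewrite setTI preimage_setT.
Qed.

Let k t (r : R) := stein t (sigma^-1 * r).
(** The derivative of [k t] off its kink is [sigma^-1 * dk t]; the chain rule factor is kept apart
    so that [dk] is bounded by 1. *)
Let dk t (r : R) := dstein t (sigma^-1 * r).
Let h t (r : R) : R := (sigma^-1 * r <= t)%R%:R.

Let mh t : measurable_fun setT (h t).
Proof.
apply: nonincreasing_measurable => // r s rs; rewrite /h ler_nat.
have [st|//] := leP (sigma^-1 * s) t.
by rewrite (le_trans _ st)// ler_pM2l ?invr_gt0.
Qed.

Let mk t : measurable_fun setT (k t).
Proof.
apply: (measurableT_comp (continuous_measurable_fun (@continuous_stein R t))).
exact: measurable_funM.
Qed.

Let mdk t : measurable_fun setT (dk t).
Proof.
rewrite (_ : dk t = fun r => sigma^-1 * r * k t r + h t r - gcdf t)//.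
apply: measurable_funB => //; apply: measurable_funD => //.
by apply: measurable_funM => //; exact: measurable_funM.
Qed.

Let h_norm t r : `|h t r| <= 1.
Proof. by rewrite /h; case: (sigma^-1 * r <= t)%R; rewrite ?normr1 ?normr0. Qed.

Let dk_norm t r : `|dk t r| <= 1.
Proof. exact: normr_dstein_le1. Qed.

Let k_norm t r : `|k t r| <= Num.sqrt (2 * pi) / 4.
Proof. by rewrite ger0_norm ?stein_ge0// stein_le_max. Qed.

Let mD j : measurable_fun setT (D j). Proof. exact: measurable_funB. Qed.
Let mDA A j : measurable_fun setT (DA A j). Proof. exact: measurable_funB. Qed.

Let rem t j w := k t (F finset.set0 w) - k t (F [set j]%SET w)
  - sigma^-1 * D j w * dk t (F finset.set0 w).

Let ik2 t : P.-integrable setT (EFin \o (fun w => k t (F finset.set0 w) ^+ 2)).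
Proof.
have i1 : P.-integrable setT
    (EFin \o (fun _ : Omega => (Num.sqrt (2 * pi) / 4 : R) ^+ 2)).
  exact: finite_measure_integrable_cst.
apply: le_integrableR i1.
  by apply: measurable_funX; exact: (measurableT_comp (mk t) (mF _)).
by move=> w; rewrite !normrX ler_sqr ?nnegrE// (le_trans (k_norm _ _))// ler_norm.
Qed.

Let irem t A j : P.-integrable setT (EFin \o (fun w => rem t j w * DA A j w)).
Proof.
have i1 := integrable_k_fresample_mul mf indX copyX if2 (mk t) (ik2 t).
have i2 := integrable_mul_bounded (integrable_fresampleB_mul mf indX copyX if2
  finset.set0 [set j]%SET A (j |: A)%SET)
  (measurableT_comp (mdk t) (mF finset.set0)) (fun w => dk_norm t (F finset.set0 w)).
have := integrableBR (integrableBR (i1 finset.set0 A (j |: A)%SET)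
  (i1 [set j]%SET A (j |: A)%SET)) (integrableZR sigma^-1 i2).
congr (P.-integrable _ _); apply/funext => w /=; congr EFin.
by rewrite /rem /DA /D /F; ring.
Qed.

(** The Stein equation leaves the mean of [dk] minus that of [sigma^-1 * k * f]. In the covariance
    formula for the latter, the linear part is [sigma ^- 2] times the mean of T against [dk]; as
    [dk] depends on X alone and is bounded, T may be replaced by [ET]. *)
Lemma stein_decomposition t :
  \int[P]_w (h t (f (X w)) - gcdf t) =
  sigma ^- 2 * \int[P]_w ((sigma ^+ 2 - ET w) * dk t (f (X w)))
  - (2 * sigma)^-1 * \int[P]_w resampling_avg (fun A j => rem t j w * DA A j w).
Proof.
have s0 : sigma != 0 by rewrite gt_eqF.
have mdkX : measurable_fun setT (fun w => dk t (f (X w))).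
  exact: (measurableT_comp (mdk t) mfX).
have mkX : measurable_fun setT (fun w => k t (f (X w))).
  exact: (measurableT_comp (mk t) mfX).
have icst (c : R) : P.-integrable setT (EFin \o (fun _ : Omega => c)).
  exact: finite_measure_integrable_cst.
have ifX : P.-integrable setT (EFin \o (fun w => f (X w))).
  have := integrable_fresample mf indX copyX if2 finset.set0.
  by congr (P.-integrable _ _); apply/funext => w; rewrite /= -F0E.
have idk : P.-integrable setT (EFin \o (fun w => dk t (f (X w)))).
  have := integrable_mul_bounded (icst 1) mdkX (fun w => dk_norm t (f (X w))).
  by congr (P.-integrable _ _); apply/funext => w; rewrite /= mul1r.
have ikf : P.-integrable setT (EFin \o (fun w => k t (f (X w)) * f (X w))).
  have := integrable_mul_bounded ifX mkX (fun w => k_norm t (f (X w))).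
  by congr (P.-integrable _ _); apply/funext => w; rewrite /= mulrC.
have [_ iET _] := condT.
have iETdk := integrable_mul_bounded iET mdkX (fun w => dk_norm t (f (X w))).
have iT := integrable_Tsum mf indX copyX if2.
have iTdk := integrable_mul_bounded iT mdkX (fun w => dk_norm t (f (X w))).
have irav := integrable_resampling_avg (fun A j _ => irem t A j).
have -> : \int[P]_w (h t (f (X w)) - gcdf t) =
    \int[P]_w dk t (f (X w)) - sigma^-1 * \int[P]_w (k t (f (X w)) * f (X w)).
  rewrite -RintegralZl// -RintegralB//; last exact: integrableZR.
  by apply: eq_Rintegral => w _; rewrite /dk /dstein /h /k; ring.
have -> : \int[P]_w ((sigma ^+ 2 - ET w) * dk t (f (X w))) =
    sigma ^+ 2 * \int[P]_w dk t (f (X w)) - \int[P]_w (ET w * dk t (f (X w))).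
  rewrite -RintegralZl// -RintegralB//; last exact: integrableZR.
  by apply: eq_Rintegral => w _; rewrite mulrBl.
rewrite -(Rintegral_cond_mul condT iT (mdk t) (dk_norm t)).
rewrite (Rintegral_mul_self mf indX copyX if2 (mk t) (ik2 t) EF0 n0).
rewrite [X in _ - _ * (_ * X)](_ : _ =
  2 * sigma^-1 * \int[P]_w (Tsum f (X w) (X' w) * dk t (f (X w))) +
  \int[P]_w resampling_avg (fun A j => rem t j w * DA A j w)).
  by field.
rewrite -RintegralZl// -RintegralD//; last exact: integrableZR.
apply: eq_Rintegral => w _.
rewrite (TsumE f (X w, X' w)) -F0E.
have -> : 2 * sigma^-1 * (2^-1 * resampling_avg (fun A j => D j w * DA A j w) *
    dk t (F finset.set0 w)) =
    (sigma^-1 * dk t (F finset.set0 w)) * resampling_avg (fun A j => D j w * DA A j w).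
  by field.
rewrite -resampling_avgZ -resampling_avgD.
by apply: eq_resampling_avg => A j _; rewrite /rem /DA /D /F; ring.
Qed.

Let c : R := Num.sqrt (2 * pi) / 4.

Let c0 : 0 <= c. Proof. by rewrite divr_ge0// ltW// sqrt2pi_gt0. Qed.

Let jump_ge0 (t w a : R) :
  0 <= a * ((w - a <= t)%R%:R - (w <= t)%R%:R).
Proof.
have [wt|wt] := leP w t; have [wat|wat] := leP (w - a) t;
  rewrite ?mulr1n ?mulr0n; nra.
Qed.

(** [ET] has mean [sigma ^+ 2], so with [dk] bounded by 1 this is a mean absolute deviation. *)
Lemma Rintegral_ET_mul_le t :
  ((sigma ^- 2 * `|\int[P]_w ((sigma ^+ 2 - ET w) * dk t (f (X w)))|)%:E <=
   (sigma ^- 2)%:E * sqrte 'V_P[ET])%E.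
Proof.
have [_ iET _] := condT.
rewrite EFinM; apply: lee_wpmul2l; first by rewrite lee_fin invr_ge0 sqr_ge0.
have EET : \int[P]_w ET w = sigma ^+ 2.
  by rewrite -(Rintegral_cond condT) (Rintegral_Tsum mf indX copyX if2 n0 EF0 EF2).
apply: le_trans (mean_abs_deviation_le iET); rewrite EET.
have i1 : P.-integrable setT (EFin \o (fun w => sigma ^+ 2 - ET w)).
  by apply: integrableBR => //; exact: finite_measure_integrable_cst.
apply: le_trans (ler_norm_Rintegral_mul i1 (measurableT_comp (mdk t) mfX)
  (fun w => dk_norm t (f (X w)))) _.
by under [leRHS]eq_integral do rewrite distrC.
Qed.

(** The two mixed moments left by the quadratic part of the remainder, extended reals because third
    and higher moments may be infinite. *)
Let J1 := (\int[P]_w (resampling_avg (fun A j =>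
  `|f (X w)| * `|D j w ^+ 2 * DA A j w|))%:E)%E.

Let J2 := (\int[P]_w (resampling_avg (fun A j => D j w ^+ 2 * `|DA A j w|))%:E)%E.

Lemma integral_jump_le t :
  (\int[P]_w (resampling_avg (fun A j => sigma^-1 * D j w *
     (h t (F [set j]%SET w) - h t (F finset.set0 w)) * `|DA A j w|))%:E <=
   (2 * sigma^-1)%:E * sqrte 'V_P[ET'])%E.
Proof.
have [_ iET _] := condT'.
have iT := integrable_Tsum' mf indX copyX if2.
have mhX : measurable_fun setT (fun w => h t (f (X w))).
  exact: (measurableT_comp (mh t) mfX).
have H := Rintegral_resampling_avg_Delta_norm mf indX copyX if2 (mh t) (h_norm t).
have icsum : P.-integrable setT (EFin \o (fun w => resampling_avg (fun A j =>
    D j w * `|DA A j w| * (h t (F [set j]%SET w) - h t (F finset.set0 w))))).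
  apply: integrable_resampling_avg => A j _.
  apply: (integrable_mul_bounded (c := 2)).
  - exact: (integrable_fresampleB_mul_norm mf indX copyX if2).
  - by apply: measurable_funB; exact: (measurableT_comp (mh t) (mF _)).
  - move=> w; apply: le_trans (ler_normB _ _) _.
    have := h_norm t (F [set j]%SET w); have := h_norm t (F finset.set0 w); lra.
have -> : (\int[P]_w (resampling_avg (fun A j => sigma^-1 * D j w *
     (h t (F [set j]%SET w) - h t (F finset.set0 w)) * `|DA A j w|))%:E =
    (sigma^-1 * (-4 * \int[P]_w (Tsum' f (X w) (X' w) * h t (f (X w)))))%:E)%E.
  rewrite -H -RintegralZl//.
  rewrite EFin_Rintegral; last exact: (integrableZR sigma^-1 icsum).
  apply: eq_integral => w _; congr EFin; rewrite -resampling_avgZ.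
  by apply: eq_resampling_avg => A j _; rewrite /D /DA /F; ring.
have ET'0 : \int[P]_w ET' w = 0.
  by rewrite -(Rintegral_cond condT') (Rintegral_Tsum' mf indX copyX if2).
have mh' : measurable_fun setT (fun r => 1 - 2 * h t r).
  by apply: measurable_funB => //; exact: measurable_funM.
have h'_norm r : `|1 - 2 * h t r| <= 1.
  rewrite /h; case: (sigma^-1 * r <= t)%R; rewrite ?mulr1n ?mulr0n ler_norml; lra.
(* Since T' has mean 0, its integral may be added at will; [1 - 2 * h] takes only the values 1 and
   -1, which halves the constant obtained by bounding [h] by 1. *)
have -> : sigma^-1 * (-4 * \int[P]_w (Tsum' f (X w) (X' w) * h t (f (X w)))) =
    2 * sigma^-1 * \int[P]_w (ET' w * (1 - 2 * h t (f (X w)))).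
  rewrite -(Rintegral_cond_mul condT' iT mh' h'_norm).
  have iTh := integrable_mul_bounded iT mhX (fun w => h_norm t (f (X w))).
  have -> : \int[P]_w (Tsum' f (X w) (X' w) * (1 - 2 * h t (f (X w)))) =
     \int[P]_w Tsum' f (X w) (X' w) -
     2 * \int[P]_w (Tsum' f (X w) (X' w) * h t (f (X w))).
    rewrite -RintegralZl// -RintegralB//; last exact: integrableZR.
    by apply: eq_Rintegral => w _; ring.
  by rewrite (Rintegral_Tsum' mf indX copyX if2); ring.
rewrite EFinM; apply: lee_wpmul2l.
  by rewrite lee_fin mulr_ge0// invr_ge0 ltW.
have := mean_abs_deviation_le iET; rewrite ET'0.
apply: le_trans.
under [leRHS]eq_integral do rewrite subr0.
apply: le_trans (ler_norm_Rintegral_mul iET (measurableT_comp mh' mfX)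
  (fun w => h'_norm (f (X w)))).
by rewrite lee_fin ler_norm.
Qed.

(** The pointwise bound has a quadratic part [B] and a jump part [C]; both are nonnegative, so the
    integral splits even when it is infinite. *)
Lemma integral_rem_le t :
  (`|\int[P]_w resampling_avg (fun A j => rem t j w * DA A j w)|%:E <=
   (2 * sigma ^+ 3)^-1%:E * J1 + (c / (2 * sigma ^+ 2))%:E * J2 +
   (2 * sigma^-1)%:E * sqrte 'V_P[ET'])%E.
Proof.
pose B j w : R := (`|sigma^-1 * F finset.set0 w| + c) * (sigma^-1 * D j w) ^+ 2 / 2.
pose C j w : R := sigma^-1 * D j w *
  (h t (F [set j]%SET w) - h t (F finset.set0 w)).
have remBC j w : `|rem t j w| <= B j w + C j w.
  have := stein_remainder_le t (sigma^-1 * F finset.set0 w) (sigma^-1 * D j w).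
  by rewrite -mulrBr /D subKr.
have C0 j w : 0 <= C j w.
  have := jump_ge0 t (sigma^-1 * F finset.set0 w) (sigma^-1 * D j w).
  by rewrite -mulrBr /D subKr.
have B0 j w : 0 <= B j w by rewrite /B divr_ge0// mulr_ge0 ?sqr_ge0// addr_ge0.
have mC j : measurable_fun setT (C j).
  apply: measurable_funM; first exact: measurable_funM.
  by apply: measurable_funB; exact: (measurableT_comp (mh t) (mF _)).
have mB j : measurable_fun setT (B j).
  apply: measurable_funM => //; apply: measurable_funM.
    apply: measurable_funD => //; apply: (measurableT_comp (@normr_measurable R setT)).
    exact: measurable_funM.
  by apply: measurable_funX; exact: measurable_funM.
have mnDA A j : measurable_fun setT (fun w => `|DA A j w|).
  exact: (measurableT_comp (@normr_measurable R setT)).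
have irav := integrable_resampling_avg (fun A j _ => irem t A j).
have avgB0 w : 0 <= resampling_avg (fun A j => B j w * `|DA A j w|).
  by apply: resampling_avg_ge0 => A j _; rewrite mulr_ge0.
have avgC0 w : 0 <= resampling_avg (fun A j => C j w * `|DA A j w|).
  by apply: resampling_avg_ge0 => A j _; rewrite mulr_ge0.
have mavgB : measurable_fun setT
    (fun w => resampling_avg (fun A j => B j w * `|DA A j w|)).
  by apply: measurable_resampling_avg => A j _; exact: measurable_funM.
have mavgC : measurable_fun setT
    (fun w => resampling_avg (fun A j => C j w * `|DA A j w|)).
  by apply: measurable_resampling_avg => A j _; exact: measurable_funM.
apply: (@le_trans _ _ (\int[P]_w ((resampling_avg (fun A j => B j w * `|DA A j w|))%:E +
   (resampling_avg (fun A j => C j w * `|DA A j w|))%:E))%E).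
  rewrite EFin_normr_Rintegral//.
  have := @le_abse_integral _ _ _ P setT _ measurableT (measurable_int _ irav).
  move/le_trans; apply; apply: ge0_le_integral => //.
  - by apply: measurableT_comp => //; exact: measurable_int irav.
  - by apply: emeasurable_funD; exact/measurable_EFinP.
  - move=> w _; rewrite -EFinD -resampling_avgD lee_fin.
    apply: le_trans (ler_norm_resampling_avg _) _.
    by apply: ler_resampling_avg => A j _; rewrite normrM -mulrDl ler_wpM2r.
rewrite ge0_integralD//; [|by move=> w _; rewrite lee_fin|exact/measurable_EFinP
  |by move=> w _; rewrite lee_fin|exact/measurable_EFinP].
apply: leeD; last exact: integral_jump_le.
have mn1 : measurable_fun setT (fun w => resampling_avg (fun A j =>
    `|f (X w)| * `|D j w ^+ 2 * DA A j w|)).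
  apply: measurable_resampling_avg => A j _; apply: measurable_funM.
    exact: (measurableT_comp (@normr_measurable R setT)).
  apply: (measurableT_comp (@normr_measurable R setT)); apply: measurable_funM => //.
  exact: measurable_funX.
have mn2 : measurable_fun setT (fun w => resampling_avg (fun A j =>
    D j w ^+ 2 * `|DA A j w|)).
  apply: measurable_resampling_avg => A j _; apply: measurable_funM => //.
  exact: measurable_funX.
have n1 w : 0 <= resampling_avg (fun A j => `|f (X w)| * `|D j w ^+ 2 * DA A j w|).
  by apply: resampling_avg_ge0 => A j _; rewrite mulr_ge0.
have n2 w : 0 <= resampling_avg (fun A j => D j w ^+ 2 * `|DA A j w|).
  by apply: resampling_avg_ge0 => A j _; rewrite mulr_ge0 ?sqr_ge0.
have a1 : 0 <= (2 * sigma ^+ 3)^-1 by rewrite invr_ge0 mulr_ge0// exprn_ge0// ltW.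
have a2 : 0 <= c / (2 * sigma ^+ 2) by rewrite divr_ge0// mulr_ge0// sqr_ge0.
(* Expansion of [B]: the factor [|sigma^-1 * f|] times [sigma ^- 2 / 2] gives the first constant,
   [c] times [sigma ^- 2 / 2] the second. *)
rewrite (eq_integral (fun w => (2 * sigma ^+ 3)^-1%:E * (resampling_avg (fun A j =>
      `|f (X w)| * `|D j w ^+ 2 * DA A j w|))%:E +
    (c / (2 * sigma ^+ 2))%:E * (resampling_avg (fun A j =>
      D j w ^+ 2 * `|DA A j w|))%:E)%E); last first.
  move=> w _; rewrite -!EFinM -EFinD -!resampling_avgZ -resampling_avgD.
  congr EFin; apply: eq_resampling_avg => A j _.
  rewrite /B F0E (normrM sigma^-1) (normrM (D j w ^+ 2)).
  rewrite (gtr0_norm (x := sigma^-1)) ?invr_gt0//.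
  rewrite (ger0_norm (x := D j w ^+ 2)) ?sqr_ge0//.
  by field; rewrite gt_eqF.
have mn1' := (measurable_EFinP _ _).2 mn1.
have mn2' := (measurable_EFinP _ _).2 mn2.
rewrite ge0_integralD//=.
- rewrite !ge0_integralZl//.
  + by move=> w _; rewrite lee_fin.
  + by move=> w _; rewrite lee_fin.
- by move=> w _; rewrite mule_ge0// lee_fin.
- exact: measurable_funeM.
- by move=> w _; rewrite mule_ge0// lee_fin.
- exact: measurable_funeM.
Qed.

(** The increments at X and at X^A have equal absolute third moments, hence a bound uniform in
    [A]. *)
Lemma integral_third_moment_le :
  (J2 <= \sum_(j < n) \int[P]_w (`|D j w| ^+ 3)%:E)%E.
Proof.
apply: (integral_resampling_avg_le (U := fun w A j => D j w ^+ 2 * `|DA A j w|)).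
- by move=> j; apply: integral_ge0 => w _; rewrite lee_fin exprn_ge0.
- move=> A j _; apply: measurable_funM; first exact: measurable_funX.
  exact: (measurableT_comp (@normr_measurable R setT)).
- by move=> w A j _; rewrite mulr_ge0 ?sqr_ge0.
- move=> A j jA; under eq_integral do rewrite -(real_normK (num_real (D j _))).
  apply: integral_sqr_mul_le => //.
  + exact: (measurableT_comp (@normr_measurable R setT)).
  + exact: (measurableT_comp (@normr_measurable R setT)).
  + exact: (integral_Delta_resample_exp mf indX copyX 3 jA).
Qed.

(** The Cauchy-Schwarz inequality separates f(X), of norm [sigma], from the increments; the
    remaining fourth power times square is of the form [u^2 v] for the squared increments, whose
    third moments agree. *)
Lemma integral_sixth_moment_le :
  (J1 <= \sum_(j < n) sigma%:E * sqrte (\int[P]_w (`|D j w| ^+ 6)%:E))%E.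
Proof.
have mDDA A j : measurable_fun setT (fun w => D j w ^+ 2 * DA A j w).
  by apply: measurable_funM => //; exact: measurable_funX.
apply: (integral_resampling_avg_le
  (U := fun w A j => `|f (X w)| * `|D j w ^+ 2 * DA A j w|)).
- by move=> j; rewrite mule_ge0 ?sqrte_ge0// lee_fin ltW.
- move=> A j _; apply: measurable_funM.
    exact: (measurableT_comp (@normr_measurable R setT)).
  exact: (measurableT_comp (@normr_measurable R setT)).
- by move=> w A j _; rewrite mulr_ge0.
- move=> A j jA; under eq_integral do rewrite -normrM.
  apply: le_trans (cauchy_schwarz_integral P mfX (mDDA A j)) _.
  have -> : sqrte (\int[P]_w (f (X w) ^+ 2)%:E) = sigma%:E.
    by rewrite -EFin_Rintegral// EF2 /sqrte sqrtr_sqr gtr0_norm.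
  apply: lee_wpmul2l; first by rewrite lee_fin ltW.
  rewrite lee_sqrt; last by apply: integral_ge0 => w _; rewrite lee_fin exprn_ge0.
  have E6 (r : R) : `|r| ^+ 6 = (r ^+ 2) ^+ 3.
    by rewrite -[in RHS](real_normK (num_real r)) -exprM.
  under [leRHS]eq_integral do rewrite E6.
  under [leLHS]eq_integral do rewrite exprMn.
  apply: integral_sqr_mul_le => //.
  + exact: measurable_funX.
  + exact: measurable_funX.
  + by move=> w; rewrite sqr_ge0.
  + by move=> w; rewrite sqr_ge0.
  + under eq_integral do rewrite -E6.
    under [RHS]eq_integral do rewrite -E6.
    exact: (integral_Delta_resample_exp mf indX copyX 6 jA).
Qed.

Lemma normal_approximation_le t :
  (`|P [set w | (sigma^-1 * f (X w) <= t)%R] - (gcdf t)%:E| <=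
   (sigma ^- 2)%:E * sqrte 'V_P[ET] + (sigma ^- 2)%:E * sqrte 'V_P[ET'] +
   ((4 * sigma ^+ 4)^-1)%:E * J1 +
   (Num.sqrt (2 * pi) / (16 * sigma ^+ 3))%:E * J2)%E.
Proof.
have s0 : sigma != 0 by rewrite gt_eqF.
have mhX : measurable_fun setT (fun w => h t (f (X w))).
  exact: (measurableT_comp (mh t) mfX).
have i1 : P.-integrable setT (EFin \o (fun _ : Omega => 1 : R)).
  exact: finite_measure_integrable_cst.
have ih : P.-integrable setT (EFin \o (fun w => h t (f (X w)))).
  have := integrable_mul_bounded i1 mhX (fun w => h_norm t (f (X w))).
  by congr (P.-integrable _ _); apply/funext => w; rewrite /= mul1r.
have mA : measurable [set w | (sigma^-1 * f (X w) <= t)%R].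
  have : measurable_fun setT (fun w => sigma^-1 * f (X w)) by exact: measurable_funM.
  move=> /(_ measurableT `]-oo, t]%classic (measurable_itv _)).
  by rewrite setTI; congr measurable; apply/seteqP; split => w /=; rewrite in_itv.
have Ph : P [set w | (sigma^-1 * f (X w) <= t)%R] = (\int[P]_w h t (f (X w)))%:E.
  rewrite EFin_Rintegral// -[X in P X]setIT -integral_indic//.
  apply: eq_integral => w _; rewrite indicE /h; congr ((nat_of_bool _)%:R%:E).
  by apply/idP/idP; rewrite inE.
have icst : P.-integrable setT (EFin \o (fun _ : Omega => gcdf t)).
  exact: finite_measure_integrable_cst.
have -> : (P [set w | (sigma^-1 * f (X w) <= t)%R] - (gcdf t)%:E =
    (\int[P]_w (h t (f (X w)) - gcdf t))%:E)%E.
  rewrite Ph RintegralB// EFinB; congr (_ - _)%E.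
  rewrite Rintegral_cst// (_ : fine (P setT) = 1) ?mulr1//.
  by rewrite probability_setT.
rewrite stein_decomposition abse_EFin.
set a := \int[P]_w ((sigma ^+ 2 - ET w) * _); set b := \int[P]_w _.
have nn : (2 * sigma)^-1 >= 0 by rewrite invr_ge0 mulr_ge0// ltW.
apply: (@le_trans _ _ ((sigma ^- 2 * `|a|)%:E + ((2 * sigma)^-1)%:E * `|b|%:E)%E).
  rewrite -EFinM -EFinD lee_fin (le_trans (ler_normB _ _))// !normrM.
  by rewrite (ger0_norm nn) ger0_norm// invr_ge0 sqr_ge0.
apply: (@le_trans _ _ ((sigma ^- 2)%:E * sqrte 'V_P[ET] +
  ((2 * sigma)^-1)%:E * ((2 * sigma ^+ 3)^-1%:E * J1 +
    (c / (2 * sigma ^+ 2))%:E * J2 + (2 * sigma^-1)%:E * sqrte 'V_P[ET']))%E).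
  apply: leeD; first exact: Rintegral_ET_mul_le.
  by apply: lee_wpmul2l; [rewrite lee_fin|exact: integral_rem_le].
have J1_ge0 : (0 <= J1)%E.
  apply: integral_ge0 => w _; rewrite lee_fin.
  by apply: resampling_avg_ge0 => A j _; rewrite mulr_ge0.
have J2_ge0 : (0 <= J2)%E.
  apply: integral_ge0 => w _; rewrite lee_fin.
  by apply: resampling_avg_ge0 => A j _; rewrite mulr_ge0 ?sqr_ge0.
have e1 : 0 <= (2 * sigma ^+ 3)^-1 by rewrite invr_ge0 mulr_ge0// exprn_ge0// ltW.
have e2 : 0 <= c / (2 * sigma ^+ 2) by rewrite divr_ge0// mulr_ge0// sqr_ge0.
have e3 : 0 <= 2 * sigma^-1 by rewrite mulr_ge0// invr_ge0 ltW.
(* Only nonnegativity of the possibly infinite terms is kept: it suffices for distributivity, and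
   the rest is arithmetic with [(2 * sigma)^-1]. *)
have := sqrte_ge0 'V_P[ET']; move: (sqrte 'V_P[ET']) => v v0.
move: J1 J2 J1_ge0 J2_ge0 => K1 K2 K1_ge0 K2_ge0.
rewrite !ge0_muleDr ?adde_ge0 ?mule_ge0 ?lee_fin// !muleA -!EFinM.
have -> : (2 * sigma)^-1 * (2 * sigma ^+ 3)^-1 = (4 * sigma ^+ 4)^-1.
  by field.
have -> : (2 * sigma)^-1 * (c / (2 * sigma ^+ 2)) =
    Num.sqrt (2 * pi) / (16 * sigma ^+ 3) by rewrite /c; field.
have -> : (2 * sigma)^-1 * (2 * sigma^-1) = sigma ^- 2 by field.
by rewrite [X in (_ + X)%E]addeC !addeA.
Qed.

End stein_bound.

Theorem theorem4p2 (R : realType) (n : nat) (E : ptopologicalType)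
    (d : measure_display) (Omega : measurableType d)
    (P : probability Omega R)
    (X X' : {RV P >-> n.-tuple (borel E)})
    (f : n.-tuple (borel E) -> R) (sigma : R)
    (d' : measure_display) (Omega' : measurableType d')
    (Q : probability Omega' R) (N : {RV Q >-> R})
    (ET ET' : Omega -> R) :
  (1 <= n)%N ->
  polish_space R E ->
  mutual_independence P (fun (i : 'I_n) (w : Omega) => tnth (X w) i) ->
  independent_copy P X X' ->
  measurable_fun [set: n.-tuple (borel E)] f ->
  let W := fun w : Omega => f (X w) in
  'E_P[W]%E = 0%E ->
  0 < sigma ->
  'E_P[fun w => (W w ^+ 2)%R]%E = (sigma ^+ 2)%:E ->
  standard_normal Q N ->
  is_cond_expectation P X (fun w => Tsum f (X w) (X' w)) ET ->
  is_cond_expectation P X (fun w => Tsum' f (X w) (X' w)) ET' ->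
  let D := fun (j : 'I_n) (w : Omega) => Delta f j (X w) (X' w) in
  let variance_terms :=
    ((sigma ^- 2)%:E * sqrte 'V_P[ET] + (sigma ^- 2)%:E * sqrte 'V_P[ET'])%E in
  let last_term :=
    ((Num.sqrt (2 * pi) / (16 * sigma ^+ 3))%:E *
       \sum_(j < n) 'E_P[fun w => (`|D j w| ^+ 3)%R])%E in
  let bound1 :=
    (variance_terms +
     ((4 * sigma ^+ 4)^-1)%:E *
       'E_P[fun w => (\sum_(A : {set 'I_n} | A \proper [set: 'I_n]%SET)
              \sum_(j | j \notin A)
                kappa A * `|f (X w)| *
                `|D j w ^+ 2 * Delta f j (resample A (X w) (X' w)) (X' w)|)%R] +
     last_term)%E in
  let bound2 :=
    (variance_terms +
     ((4 * sigma ^+ 3)^-1)%:E *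
       (\sum_(j < n) sqrte 'E_P[fun w => (`|D j w| ^+ 6)%R]) +
     last_term)%E in
  (kolmogorov_distance P Q (fun w => (sigma^-1 * W w)%R) N <= bound1)%E /\
  (bound1 <= bound2)%E.
Proof.
move=> n0 _ indX copyX mf W EW sigma0 EW2 lawN condT condT' D vt lt b1 b2.
have mfX : measurable_fun setT (fun w => f (X w)) by exact: measurableT_comp.
have E2 : (\int[P]_w (f (X w) ^+ 2)%:E = (sigma ^+ 2)%:E)%E.
  by move: EW2; rewrite unlock.
(* All later integrability is derived from this finite second moment. *)
have if2 : P.-integrable setT (EFin \o (fun w => f (X w) ^+ 2)).
  apply/integrableP; split; first by apply/measurable_EFinP; exact: measurable_funX.
  under eq_integral do rewrite /= ger0_norm ?sqr_ge0//.
  by rewrite E2 ltry.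
have EF0 : \int[P]_w f (X w) = 0 by move: EW; rewrite unlock /Rintegral => ->.
have EF2 : \int[P]_w (f (X w) ^+ 2) = sigma ^+ 2 by rewrite /Rintegral E2.
pose D0 j w := fresample f finset.set0 (X w, X' w) -
  fresample f [set j]%SET (X w, X' w).
have DE j w : D j w = D0 j w by exact: (DeltaE f j (X w, X' w)).
have moment m j : 'E_P[fun w => (`|D j w| ^+ m)%R]%E =
    (\int[P]_w (`|D0 j w| ^+ m)%:E)%E.
  by rewrite unlock; apply: eq_integral => w _; rewrite DE.
have m3 := integral_third_moment_le mf indX copyX.
have m6 := integral_sixth_moment_le mf indX copyX if2 sigma0 EF2.
have approx := normal_approximation_le n0 mf indX copyX if2 EF0 sigma0 EF2 condT condT'.
rewrite -/vt in approx.
have c3 : (0 <= (Num.sqrt (2 * pi) / (16 * sigma ^+ 3))%:E)%E.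
  by rewrite lee_fin divr_ge0// mulr_ge0// exprn_ge0// ltW.
have c4 : (0 <= ((4 * sigma ^+ 4)^-1)%:E)%E.
  by rewrite lee_fin invr_ge0 mulr_ge0// exprn_ge0// ltW.
have M3 : (\sum_(j < n) 'E_P[fun w => (`|D j w| ^+ 3)%R] =
    \sum_(j < n) \int[P]_w (`|D0 j w| ^+ 3)%:E)%E by exact: eq_bigr.
have M6 : (\sum_(j < n) sqrte 'E_P[fun w => (`|D j w| ^+ 6)%R] =
    \sum_(j < n) sqrte (\int[P]_w (`|D0 j w| ^+ 6)%:E))%E.
  by apply: eq_bigr => j _; rewrite moment.
rewrite /b1 /b2 /lt M3 M6.
set J := 'E_P[_]%E.
have JE : J = (\int[P]_w (resampling_avg (fun (A : {set 'I_n}) (j : 'I_n) =>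
    `|f (X w)| * `|D0 j w ^+ 2 * (fresample f A (X w, X' w) -
                         fresample f (j |: A)%SET (X w, X' w))|))%:E)%E.
  rewrite /J unlock; apply: eq_integral => w _; congr EFin.
  apply: eq_bigr => A _; apply: eq_bigr => j _.
  by rewrite -mulrA DE (Delta_resampleE f A j (X w, X' w)).
split.
  apply: ge_ereal_sup => _ [t _ <-].
  have -> : Q [set w | N w <= t] = (gcdf t)%:E.
    rewrite gcdf_fin -(lawN _ (measurable_itv _)).
    by rewrite (_ : [set w | N w <= t] = N @^-1` `]-oo, t])//;
      apply/seteqP; split => w /=; rewrite in_itv.
  apply: le_trans (approx t) _.
  (* The bound does not depend on [t]; only its mixed third-order term remains to be replaced, by
     the third moments in [m3]. *)
  rewrite JE; apply: leeD => //; exact: lee_wpmul2l.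
apply: leeD => //; apply: leeD => //.
apply: (@le_trans _ _ (((4 * sigma ^+ 4)^-1)%:E * (\sum_(j < n) sigma%:E *
    sqrte (\int[P]_w (`|D0 j w| ^+ 6)%:E)))%E).
  by apply: lee_wpmul2l => //; rewrite JE.
rewrite -ge0_sume_distrr; last by move=> j _; exact: sqrte_ge0.
rewrite muleA -EFinM.
(* The norm of f(X) absorbs one power of [sigma]. *)
have -> : (4 * sigma ^+ 4)^-1 * sigma = (4 * sigma ^+ 3)^-1.
  by field; rewrite gt_eqF.
by [].
Qed.
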